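(* Let $\sigma>0$ and $\varepsilon>0$. Let $0\le g_0\in L^1_4$ satisfy $$\int_{\mathbb{R}}g_0\,dv=1,\quad \int_{\mathbb{R}}v\,g_0\,dv=0,\quad \int_{\mathbb{R}}\frac{v^2}{2}\,g_0\,dv=1,\quad \int_{\mathbb{R}}v^3g_0\,dv=0,\quad \int_{\mathbb{R}}v^4g_0\,dv=\mu,$$ where $\mu$ is a positive constant. Let $g$ be the solution to the heat equation $\frac{\partial g}{\partial t}=\sigma^2\frac{\partial^2g}{\partial v^2}$ on $\mathbb{R}$ with initial condition $g_0$, and let $$g_{\varepsilon,reg}(\cdot,t)=g_0*P_{\varepsilon,reg}(\cdot,t),$$ where $P_{\varepsilon,reg}$ is the regularized kernel associated with the Rosenau kernel $M_\varepsilon(v)=\frac{1}{2\varepsilon}e^{-|v|/\varepsilon}$ and $\lambda=\sigma^2$, that is, the function whose Fourier transform in $v$ is $$\widehat P_{\varepsilon,reg}(\xi,t)=e^{-\lambda t/\varepsilon^2}\left(e^{\widehat{M_\varepsilon}(\xi)\lambda t/\varepsilon^2}-\left(1-\widehat{M_\varepsilon}(\xi)\right)\right).$$ Then $$\lim_{t\to\infty}\left\|g(t)-g_{\varepsilon,reg}(t)\right\|_{L^1}=0.$$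
   Context: The Fourier transform is $\widehat f(\xi)=\int_{\mathbb{R}}e^{-i\xi v}f(v)\,dv$; $*$ is convolution in $v$. The weighted space $L^1_4$ is the set of measurable $f:\mathbb{R}\to\mathbb{R}$ with $\int_{\mathbb{R}}|f(v)|(1+v^2)^2\,dv<\infty$. The solution of the heat equation is $g(\cdot,t)=g_0*\Omega_\sigma(\cdot,t)$ with $\Omega_\sigma(v,t)=\frac{1}{\sqrt{4\pi\sigma^2t}}\exp\left(-\frac{v^2}{4\sigma^2t}\right)$. The Rosenau approximation to the heat equation is $\frac{\partial g_\varepsilon}{\partial t}=\frac{\lambda}{\varepsilon^2}\left[M_\varepsilon*g_\varepsilon-g_\varepsilon\right]$; its fundamental solution has Fourier transform $\widehat{P}_{\varepsilon,reg}(\xi,t)+\left(1-\widehat{M_\varepsilon}(\xi)\right)e^{-\lambda t/\varepsilon^2}$, so $P_{\varepsilon,reg}$ is obtained from it by discarding the second term. Here $g(t)$ and $g_{\varepsilon,reg}(t)$ denote $g(\cdot,t)$ and $g_{\varepsilon,reg}(\cdot,t)$. *)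

(* Defs.v *)
From HB Require Import structures.
From mathcomp Require Import all_boot all_order all_algebra.
From mathcomp Require Import complex.
From mathcomp Require Import all_classical all_reals all_analysis.
Set Implicit Arguments.
Unset Strict Implicit.
Unset Printing Implicit Defensive.
Import Order.TTheory GRing.Theory Num.Theory.
Import numFieldNormedType.Exports.
Local Open Scope classical_set_scope.
Local Open Scope ring_scope.
Local Open Scope complex_scope.

Section Defs.
Context {R : realType}.
Implicit Types f g : R -> R.

Definition cexp (z : R[i]) : R[i] :=
  (expR (complex.Re z))%:C * (cos (complex.Im z) +i* sin (complex.Im z)).

Definition cintegral (h : R -> R[i]) : R[i] :=
  (\int[lebesgue_measure]_v complex.Re (h v)) +i*
  (\int[lebesgue_measure]_v complex.Im (h v)).

Definition fourier f (xi : R) : R[i] :=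
  cintegral (fun v => cexp (- 'i * xi%:C * v%:C) * (f v)%:C).

(* For a function f that is not integrable, [fourier f] is a junk value, so
   integrability is part of the notion. *)
Definition has_fourier_transform f (F : R -> R[i]) : Prop :=
  (@lebesgue_measure R).-integrable setT (EFin \o f) /\ fourier f = F.

(* For integrable f and g the integral converges at almost every v; elsewhere
   the value is junk. *)
Definition convolution f g (v : R) : R :=
  \int[lebesgue_measure]_w (f (v - w) * g w).

Definition L1_4 f : Prop :=
  measurable_fun setT f /\
  (\int[@lebesgue_measure R]_v (`|f v| * (1 + v ^+ 2) ^+ 2)%:E < +oo)%E.

Definition heat_kernel (sigma t v : R) : R :=
  (Num.sqrt (4 * pi * sigma ^+ 2 * t))^-1 *
  expR (- (v ^+ 2 / (4 * sigma ^+ 2 * t))).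

Definition heat_solution (sigma : R) (g0 : R -> R) (t : R) : R -> R :=
  convolution g0 (heat_kernel sigma t).

Definition rosenau_kernel (eps v : R) : R :=
  (2 * eps)^-1 * expR (- (`|v| / eps)).

Definition reg_kernel_hat (lambda eps t xi : R) : R[i] :=
  let a := (lambda * t / eps ^+ 2)%:C in
  let Mhat := fourier (rosenau_kernel eps) xi in
  cexp (- a) * (cexp (Mhat * a) - (1 - Mhat)).

(* The Fourier transform determines P t up to a null set. *)
Definition is_reg_kernel (lambda eps : R) (P : R -> R -> R) : Prop :=
  forall t, 0 < t ->
    has_fourier_transform (P t) (reg_kernel_hat lambda eps t).

End Defs.

(* Main.v *)
Require Import Defs.
From HB Require Import structures.
From mathcomp Require Import all_boot all_order all_algebra.
From mathcomp Require Import complex.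
From mathcomp Require Import all_classical all_reals all_analysis.
From mathcomp Require Import measurable_realfun.
From mathcomp Require Import ring lra.
Import Order.TTheory GRing.Theory Num.Theory.
Import numFieldNormedType.Exports.
Local Open Scope classical_set_scope.
Local Open Scope ring_scope.

(** Put T = lambda t with lambda = sigma^2, and b = 1 / eps^2.  Let G_s be the
    centred Gaussian density of variance 2 s, so that the heat kernel at time t
    is G_T.  By Young's inequality ([convolutionB_L1_le]) convolution with the
    integrable function g0 is bounded on L^1, and it is enough to show that the
    two kernels satisfy || G_T - P_t ||_1 -> 0.

    The idea is that P_t is a mixture of Gaussians over a random time.  The
    Laplace density M_eps has Fourier transform b / (b + xi^2)
    ([fourier_rosenau_kernel]), which is the Laplace transform at u = xi^2 of the
    exponential law of rate b, while G_s has transform exp (- s xi^2)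
    ([fourier_cos_gauss]).  Expanding the exponential in the transform of P_t
    shows that it is the Laplace transform at xi^2 of a probability density
    rho_T on the half-line: a Poisson mixture of gamma laws
    ([mixing_density], [laplace_mixing_density]).  Therefore P_t is almost
    everywhere the integral of G_s rho_T(s) over s
    ([reg_kernel_gauss_mixture]).

    This identification rests on the injectivity of the Fourier transform on L^1
    ([fourier_injective]).  If the transform of h vanishes then so does h * G_s
    for every s > 0, because G_s is itself a Fourier transform; letting s tend to
    0 against the indicator of a half-line shows that the primitive of h is 0.

    Two estimates conclude.  First, if p <= q then sqrt (p / q) G_p <= G_q
    pointwise, whence || G_p - G_q ||_1 <= 2 (1 - p / q), and in particular
    || G_T - G_s ||_1 <= 2 |1 - exp (1 - s / T)| ([gauss_L1_dist_expR]).
    Averaging over s ([gauss_mixture_L1_dist]), it remains to see that s / T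
    concentrates at 1 under rho_T.  Second, the mean of (1 - exp (1 - s / T))^2
    under rho_T is a combination of Laplace transforms of rho_T at 0, 1 / T and
    2 / T, which is explicit and tends to 1 - 2 e e^-1 + e^2 e^-2 = 0
    ([mixing_spread_cvg]). *)

(** * Reflections and translations of the line *)

Section line.
Context {R : realType}.
Local Notation mu := (@lebesgue_measure R).

(** Reflections give everything at once: two of them compose to a translation,
    and the one with c = 0 handles parity. *)
Lemma lebesgue_measure_reflect (c : R) (A : set R) : measurable A ->
  pushforward mu (fun x : R => (c - x : measurableTypeR R)) A = mu A.
Proof.
pose T := measurableTypeR R.
have mcx : measurable_fun [set: T] (fun x : T => (c - (x : R) : T)).
  exact: measurable_funB.
move=> mA; apply/esym.
pose mphi := isMeasurableFun.Build _ _ _ _ _ mcx.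
pose phi : {mfun T >-> T} := HB.pack (fun x : T => (c - (x : R) : T)) mphi.
apply: (@lebesgue_measure_unique _ (pushforward mu phi)) => // _ [[a b]] _ <-.
rewrite /pushforward.
transitivity (mu `[c - b, c - a[%classic); last first.
  congr (mu _); apply/seteqP; split => x /=; rewrite !in_itv/=; lra.
rewrite !lebesgue_measure_itv/= !lte_fin ltrD2l ltrN2 -!EFinB.
by case: ifP => // _; congr EFin; lra.
Qed.

Lemma integral_reflect (c : R) (f : R -> \bar R) : measurable_fun setT f ->
  (\int[mu]_x f (c - x)%R = \int[mu]_x f x)%E.
Proof.
have mcx : measurable_fun [set: R] (fun x : R => (c - x : measurableTypeR R)).
  exact: measurable_funB.
have ge0 (g : R -> \bar R) : measurable_fun setT g -> (forall x, 0 <= g x)%E ->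
    (\int[mu]_x g (c - x)%R = \int[mu]_x g x)%E.
  move=> mg g0.
  transitivity
    (\int[pushforward mu (fun x : R => (c - x)%R : measurableTypeR R)]_x g x)%E.
    by rewrite ge0_integral_pushforward.
  by apply: eq_measure_integral => //= A mA _; exact: lebesgue_measure_reflect.
move=> mf; rewrite integralE [RHS]integralE; congr (_ - _)%E.
- rewrite -(ge0 (f^\+)%E) ?funepos_ge0//; last exact: measurable_funepos.
  by apply: eq_integral => x _; rewrite !funeposE.
- rewrite -(ge0 (f^\-)%E) ?funeneg_ge0//; last exact: measurable_funeneg.
  by apply: eq_integral => x _; rewrite !funenegE.
Qed.

Lemma integrable_reflect (c : R) (f : R -> \bar R) :
  mu.-integrable setT f -> mu.-integrable setT (fun x => f (c - x)).
Proof.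
move=> /integrableP[mf foo]; apply/integrableP; split.
  by apply: measurableT_comp => //; exact: measurable_funB.
by rewrite (integral_reflect c (fun x => `|f x|)%E)//; exact: measurableT_comp.
Qed.

Lemma Rintegral_reflect (c : R) (f : R -> R) : measurable_fun setT f ->
  \int[mu]_x f (c - x) = \int[mu]_x f x.
Proof.
move=> mf; rewrite /Rintegral (integral_reflect c (EFin \o f))//.
exact/measurable_EFinP.
Qed.

Lemma Rintegral_odd (f : R -> R) : mu.-integrable setT (EFin \o f) ->
  (forall x, f (- x) = - f x) -> \int[mu]_x f x = 0.
Proof.
move=> intf fN.
have mf : measurable_fun setT f by apply/measurable_EFinP; exact: measurable_int intf.
have := Rintegral_reflect 0 f mf.
under eq_Rintegral do rewrite sub0r fN -mulN1r.
rewrite RintegralZl//; lra.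
Qed.

(** The inverse is y * (y ^+ 2) `^ (-1), also at y = 0, and real powers are
    measurable; so the zeros of f need no separate treatment. *)
Lemma measurable_funVr d (T : measurableType d) (f : T -> R) :
  measurable_fun setT f -> measurable_fun setT (fun x => (f x)^-1).
Proof.
move=> mf.
rewrite (_ : (fun x => _) = fun x => f x * ((f x) ^+ 2) `^ (-1)).
  apply: measurable_funM => //.
  by apply: (measurableT_comp (measurable_powR _)); exact: measurable_funX.
apply/funext => x; rewrite powR_inv1 ?sqr_ge0//.
have [->|fx0] := eqVneq (f x) 0; first by rewrite invr0 mul0r.
by field.
Qed.

End line.

(** * Fubini for real-valued integrals *)

Section fubini_real.
Context {R : realType}.
Local Notation mu := (@lebesgue_measure R).

Lemma integrable_prodP (f : R * R -> R) : measurable_fun setT f ->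
  ((\int[mu]_x \int[mu]_y (`|f (x, y)|)%:E < +oo)%E ->
  (mu \x mu)%E.-integrable setT (EFin \o f)).
Proof.
move=> mf fy.
have mEf : measurable_fun setT (EFin \o f) by exact/measurable_EFinP.
exact: ((@integrable12ltyP _ _ _ _ R mu mu (EFin \o f) mEf).2 fy).
Qed.

(** An inner real-valued integral agrees with the extended one only where the
    section is integrable, which is almost everywhere. *)
Lemma Rintegral_Fubini (f : R * R -> R) :
  (mu \x mu)%E.-integrable setT (EFin \o f) ->
  \int[mu]_x \int[mu]_y f (x, y) = \int[mu]_y \int[mu]_x f (x, y).
Proof.
move=> intf; rewrite /Rintegral.
have i1 := ae_integrable1 intf.
have i2 := ae_integrable2 intf.
congr fine.
transitivity (\int[mu]_x \int[mu]_y (f (x, y))%:E)%E.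
  apply: ae_eq_integral => //.
  - apply/measurable_EFinP; apply: measurableT_comp => //.
    exact: measurable_fubini_F intf.
  - exact: measurable_fubini_F intf.
  - apply: filterS i1 => x ix _; rewrite fineK//.
    exact: integrable_fin_num.
rewrite (Fubini intf).
apply: ae_eq_integral => //.
- exact: measurable_fubini_G intf.
- apply/measurable_EFinP; apply: measurableT_comp => //.
  exact: measurable_fubini_G intf.
- apply: filterS i2 => x ix _; rewrite fineK//.
  exact: integrable_fin_num.
Qed.
End fubini_real.

(** * The fundamental theorem of calculus on the whole line *)

Section ftc_line.
Context {R : realType}.
Local Notation mu := (@lebesgue_measure R).

Lemma is_derive_continuous (F f : R -> R) :
  (forall x, is_derive x (1 : R) F (f x)) -> continuous F.
Proof.
move=> dF x; apply: differentiable_continuous; apply/derivable1_diffP.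
by have [] := dF x.
Qed.

Lemma derivable_continuous (f : R -> R) :
  (forall x, derivable f x 1) -> continuous f.
Proof.
by move=> df x; apply: differentiable_continuous; apply/derivable1_diffP.
Qed.

Lemma Rintegral_segments_cvg (f : R -> R) : mu.-integrable setT (EFin \o f) ->
  \int[mu]_(x in `[- n.+1%:R, n.+1%:R]) f x @[n --> \oo] --> \int[mu]_x f x.
Proof.
move=> intf.
have mf : measurable_fun setT (EFin \o f) by exact: measurable_int intf.
apply: fine_cvg; rewrite fineK; last exact: integrable_fin_num.
under eq_fun do rewrite integral_mkcond.
have [] // := @dominated_convergence _ _ _ mu _ measurableT
  (fun n => (EFin \o f) \_ `[- n.+1%:R, n.+1%:R]) (EFin \o f) (abse \o (EFin \o f)).
- by move=> n; apply/(measurable_restrictT _ _).1 => //; exact: measurable_funTS.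
- apply: aeW => x _; apply: cvg_near_cst.
  exists (Num.trunc `|x|) => // n /= xn; rewrite patchE ifT// inE/= in_itv/=.
  rewrite -ler_norml; apply: le_trans (ltW (truncnS_gt _)) _.
  by rewrite ler_nat ltnS.
- exact: integrable_abse.
- by apply: aeW => x n _; rewrite patchE; case: ifP => //=; rewrite normr0 lee_fin.
Qed.

(** The integrals over [-n-1, n+1] are F (n+1) - F (-n-1) and tend to 0; by
    dominated convergence they also tend to the whole integral. *)
Lemma Rintegral_derivative (F f : R -> R) :
  (forall x, is_derive x (1 : R) F (f x)) -> continuous f ->
  mu.-integrable setT (EFin \o f) ->
  F x @[x --> +oo] --> 0 -> F x @[x --> -oo] --> 0 -> \int[mu]_x f x = 0.
Proof.
move=> dF cf intf Fy FNy.
have cF := is_derive_continuous _ _ dF.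
have : \int[mu]_(x in `[- n.+1%:R, n.+1%:R]) f x @[n --> \oo] --> (0 : R).
  have -> : (fun n => \int[mu]_(x in `[- n.+1%:R, n.+1%:R]) f x) =
      (fun n => F n.+1%:R - F (- n.+1%:R)).
    apply/funext => n; rewrite /Rintegral (@continuous_FTC2 _ f F)//.
    - by rewrite -subr_gt0 opprK addr_gt0.
    - exact: continuous_subspaceT.
    - split; first by move=> x _; have [] := dF x.
      + exact/cvg_at_right_filter/cF.
      + exact/cvg_at_left_filter/cF.
    - by move=> x _; rewrite derive1E; have [] := dF x.
  rewrite -(subr0 0).
  have nS : (n.+1%:R : R) @[n --> \oo] --> +oo.
    by rewrite (cvg_shiftS (fun n => n%:R : R)); exact: cvgr_idn.
  apply: cvgB; first exact: cvg_comp nS Fy.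
  by apply: cvg_comp FNy; apply/cvgNrNy.
by move=> /cvg_unique/(_ (Rintegral_segments_cvg _ intf)) <-.
Qed.

End ftc_line.

(** * Gaussian densities *)

Section gauss.
Context {R : realType}.
Local Notation mu := (@lebesgue_measure R).

(** The centred Gaussian density of variance 2 s, that is, the kernel at time s
    of the heat equation with unit diffusion.  It is identically 0 for s <= 0,
    because the square root of a nonpositive number is 0 and so is 0^-1. *)
Definition gauss (s v : R) : R :=
  (Num.sqrt (4 * pi * s))^-1 * expR (- (v ^+ 2 / (4 * s))).

Lemma gaussE s : 0 < s -> gauss s = normal_pdf 0 (Num.sqrt (2 * s)).
Proof.
move=> s0; have s2 : Num.sqrt (2 * s) != 0 by rewrite gt_eqF// sqrtr_gt0; lra.
rewrite normal_pdfE//; apply/funext => v.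
rewrite /gauss /normal_peak /normal_fun subr0 sqr_sqrtr; last lra.
congr ((Num.sqrt _)^-1 * expR _); first by rewrite -mulr_natr; lra.
by rewrite mulNr; congr (- (_ / _)); rewrite -mulr_natr; lra.
Qed.

Lemma heat_kernelE sigma t v : heat_kernel sigma t v = gauss (sigma ^+ 2 * t) v.
Proof. by rewrite /heat_kernel /gauss !mulrA. Qed.

Lemma gauss_ge0 s v : 0 <= gauss s v.
Proof. by rewrite mulr_ge0 ?expR_ge0// invr_ge0 sqrtr_ge0. Qed.

Lemma gauss_even s v : gauss s (- v) = gauss s v.
Proof. by rewrite /gauss sqrrN. Qed.

Lemma gauss_le0 s v : s <= 0 -> gauss s v = 0.
Proof.
move=> s0; rewrite /gauss ler0_sqrtr ?invr0 ?mul0r//.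
by rewrite mulr_ge0_le0 ?mulr_ge0 ?pi_ge0.
Qed.

Lemma integrable_gauss s : mu.-integrable setT (EFin \o gauss s).
Proof.
have [s0|s0] := ltP 0 s; first by rewrite gaussE//; exact: integrable_normal_pdf.
rewrite (_ : EFin \o _ = cst 0%E); first exact: integrable0.
by apply/funext => v /=; rewrite gauss_le0.
Qed.

Lemma integral_gauss s : 0 < s -> (\int[mu]_v (gauss s v)%:E = 1)%E.
Proof. by move=> s0; rewrite gaussE// integral_normal_pdf. Qed.

Lemma Rintegral_gauss s : 0 < s -> \int[mu]_v gauss s v = 1.
Proof. by move=> s0; rewrite /Rintegral integral_gauss. Qed.

Lemma is_derive_gauss s v : s != 0 ->
  is_derive v (1 : R) (gauss s) (- (v / (2 * s)) * gauss s v).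
Proof.
move=> s0; rewrite /gauss.
apply: trigger_derive; rewrite /GRing.scale/=.
by set c := (Num.sqrt _)^-1; field.
Qed.

Lemma continuous_gauss s : continuous (gauss s).
Proof.
have [->|s0] := eqVneq s 0.
  rewrite (_ : gauss 0 = cst 0); first exact: cst_continuous.
  by apply/funext => v; rewrite gauss_le0.
by apply: is_derive_continuous => v; exact: is_derive_gauss.
Qed.

Lemma measurable_gauss s : measurable_fun setT (gauss s).
Proof. exact: continuous_measurable_fun (continuous_gauss s). Qed.

(** Half of the exponent is traded for a wider Gaussian.  The spare exponential
    absorbs polynomial growth at infinity, and it is small away from the origin
    when s is small. *)
Lemma gauss_factor s v : 0 < s ->
  gauss s v = Num.sqrt 2 * expR (- (v ^+ 2 / (8 * s))) * gauss (2 * s) v.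
Proof.
move=> s0; rewrite /gauss.
have -> : Num.sqrt (4 * pi * (2 * s)) = Num.sqrt 2 * Num.sqrt (4 * pi * s).
  by rewrite -sqrtrM//; congr Num.sqrt; ring.
have -> : - (v ^+ 2 / (4 * s)) = - (v ^+ 2 / (8 * s)) + - (v ^+ 2 / (4 * (2 * s))).
  by field; rewrite gt_eqF.
rewrite expRD; field; rewrite !gt_eqF// sqrtr_gt0//.
by rewrite mulr_gt0// mulr_gt0// pi_gt0.
Qed.

Lemma gauss_cvgy s : 0 < s -> gauss s v @[v --> +oo] --> 0.
Proof.
move=> s0; rewrite -(mulr0 (Num.sqrt (4 * pi * s))^-1).
apply: cvgMr.
apply: (@cvg_comp _ _ _ (fun v => v ^+ 2 / (4 * s)) (fun x => expR (- x)) _ +oo).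
  apply: gt0_cvgMly; first by rewrite invr_gt0; lra.
  exact: cvgr_expr2.
exact: cvgr_expR.
Qed.

Lemma gauss_cvgNy s : 0 < s -> gauss s v @[v --> -oo] --> 0.
Proof.
move=> s0; apply/cvgNy_compNP; rewrite (_ : gauss s \o _ = gauss s).
  exact: gauss_cvgy.
by apply/funext => v /=; rewrite gauss_even.
Qed.

(** By [gauss_factor], since |v| <= (1 + 8 s) exp (v^2 / (8 s)). *)
Lemma integrable_mul_gauss s : 0 < s ->
  mu.-integrable setT (EFin \o (fun v => `|v| * gauss s v)).
Proof.
move=> s0.
have i2 : mu.-integrable setT (EFin \o
    (fun v => (1 + 8 * s) * Num.sqrt 2 * gauss (2 * s) v)).
  by apply: (integrableZl measurableT) (integrable_gauss _).
apply: le_integrable i2 => //.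
  apply/measurable_EFinP/measurable_funM; last exact: measurable_gauss.
  exact: normr_measurable.
move=> v _ /=; rewrite lee_fin ger0_norm ?mulr_ge0 ?gauss_ge0//.
apply: le_trans (ler_norm _).
rewrite gauss_factor// mulrA; apply: ler_wpM2r; first exact: gauss_ge0.
rewrite (mulrC (Num.sqrt 2)) mulrA.
apply: ler_wpM2r; first exact: sqrtr_ge0.
rewrite expRN ler_pdivrMr ?expR_gt0//.
have := expR_ge1Dx (v ^+ 2 / (8 * s)); rewrite -(ler_pM2l (_ : 0 < 1 + 8 * s)); last lra.
apply: le_trans.
have -> : (1 + 8 * s) * (1 + v ^+ 2 / (8 * s)) = 1 + 8 * s + v^+2 + v ^+ 2 / (8 * s).
  by field; rewrite gt_eqF.
have : 0 <= v ^+ 2 / (8 * s) by rewrite divr_ge0 ?sqr_ge0//; lra.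
rewrite -(real_normK (num_real v)); have := normr_ge0 v; nra.
Qed.

End gauss.

(** * The Fourier transform of a Gaussian *)

Section gauss_fourier.
Context {R : realType}.
Local Notation mu := (@lebesgue_measure R).

Lemma measurable_cosM (xi : R) : measurable_fun setT (fun v : R => cos (xi * v)).
Proof.
apply: continuous_measurable_fun.
by apply: (is_derive_continuous _ (fun v => - (xi * sin (xi * v)))) => v;
  apply: trigger_derive; rewrite /GRing.scale/=; ring.
Qed.

Lemma measurable_sinM (xi : R) : measurable_fun setT (fun v : R => sin (xi * v)).
Proof.
apply: continuous_measurable_fun.
by apply: (is_derive_continuous _ (fun v => xi * cos (xi * v))) => v;
  apply: trigger_derive; rewrite /GRing.scale/=; ring.
Qed.

Lemma integrableM_le1 (c f : R -> R) : measurable_fun setT c ->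
  (forall v, `|c v| <= 1) -> mu.-integrable setT (EFin \o f) ->
  mu.-integrable setT (EFin \o (fun v => c v * f v)).
Proof.
move=> mc c1 intf; apply: le_integrable (intf) => //.
  apply/measurable_EFinP/measurable_funM => //; apply/measurable_EFinP.
  exact: measurable_int intf.
by move=> v _ /=; rewrite lee_fin normrM ler_piMl.
Qed.

Lemma integrable_cosM (xi : R) (f : R -> R) : mu.-integrable setT (EFin \o f) ->
  mu.-integrable setT (EFin \o (fun v => cos (xi * v) * f v)).
Proof.
by apply: integrableM_le1; [exact: measurable_cosM|move=> v; exact: cos_max].
Qed.

Lemma integrable_sinM (xi : R) (f : R -> R) : mu.-integrable setT (EFin \o f) ->
  mu.-integrable setT (EFin \o (fun v => sin (xi * v) * f v)).
Proof.
by apply: integrableM_le1; [exact: measurable_sinM|move=> v; exact: sin_max].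
Qed.

Lemma integrable_mulx_gauss s : 0 < s ->
  mu.-integrable setT (EFin \o (fun v => v * gauss s v)).
Proof.
move=> s0; apply: le_integrable (integrable_mul_gauss s s0) => //.
  by apply/measurable_EFinP/measurable_funM => //; exact: measurable_gauss.
by move=> v _ /=; rewrite lee_fin !normrM normr_id.
Qed.

(** Integration by parts with v G_s(v) = - 2 s G_s'(v): the function
    sin (xi v) G_s(v) vanishes at both ends, so its derivative has integral 0. *)
Lemma gauss_fourier_parts s xi : 0 < s ->
  \int[mu]_v (sin (xi * v) * (v * gauss s v)) =
  2 * s * xi * \int[mu]_v (cos (xi * v) * gauss s v).
Proof.
move=> s0; have sn0 : s != 0 by rewrite gt_eqF.
have ic := integrable_cosM xi _ (integrable_gauss s).
have is_ := integrable_sinM xi _ (integrable_mulx_gauss s s0).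
have dG v := is_derive_gauss s v sn0.
have icZ : mu.-integrable setT
    (EFin \o (fun v => xi * (cos (xi * v) * gauss s v))).
  exact: (integrableZl measurableT) ic.
have isZ : mu.-integrable setT
    (EFin \o (fun v => (2 * s)^-1 * (sin (xi * v) * (v * gauss s v)))).
  exact: (integrableZl measurableT) is_.
have : \int[mu]_v (xi * (cos (xi * v) * gauss s v) -
                   (2 * s)^-1 * (sin (xi * v) * (v * gauss s v))) = 0.
  apply: (Rintegral_derivative (fun v => sin (xi * v) * gauss s v)).
  - by move=> v; apply: trigger_derive; rewrite /GRing.scale/=; field.
  - by apply: derivable_continuous => v; exact: ex_derive.
  - by have := integrableB measurableT icZ isZ.
  - apply: norm_cvg0; apply: (squeeze_cvgr _ (cvg_cst 0) (gauss_cvgy _ s0)).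
    by apply: nearW => v; rewrite normr_ge0 normrM (ger0_norm (gauss_ge0 _ _))
      ler_piMl ?gauss_ge0// sin_max.
  - apply: norm_cvg0; apply: (squeeze_cvgr _ (cvg_cst 0) (gauss_cvgNy _ s0)).
    by apply: nearW => v; rewrite normr_ge0 normrM (ger0_norm (gauss_ge0 _ _))
      ler_piMl ?gauss_ge0// sin_max.
rewrite RintegralB//= !RintegralZl// => /eqP; rewrite subr_eq0 => /eqP e.
by rewrite -(mulrA (2 * s)) e mulVKf// mulf_neq0.
Qed.

(** Differentiation under the integral, dominated by |v| G_s(v). *)
Lemma is_derive_gauss_fourier s xi : 0 < s ->
  is_derive xi (1 : R) (fun xi => \int[mu]_v (cos (xi * v) * gauss s v))
    (- \int[mu]_v (sin (xi * v) * (v * gauss s v))).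
Proof.
move=> s0.
pose f (xi v : R) := cos (xi * v) * gauss s v.
have d1 x v : is_derive x (1 : R) (f ^~ v) (- (sin (x * v) * (v * gauss s v))).
  by apply: trigger_derive; rewrite /GRing.scale/=; ring.
have hI : (`]xi - 1, xi + 1[%classic : set R) xi by rewrite /= in_itv/=; lra.
have hi x : (`]xi - 1, xi + 1[%classic : set R) x ->
    mu.-integrable setT (EFin \o f x).
  by move=> _; exact: integrable_cosM (integrable_gauss s).
have hd x v : (`]xi - 1, xi + 1[%classic : set R) x -> setT v ->
    derivable (f ^~ v) x 1.
  by move=> _ _; exact: ex_derive.
have h0 v : 0 <= `|v| * gauss s v by rewrite mulr_ge0// gauss_ge0.
have hb x v : (`]xi - 1, xi + 1[%classic : set R) x -> setT v ->
    `|partial1of2 f x v| <= `|v| * gauss s v.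
  move=> _ _; rewrite partial1of2E derive_val normrN normrM normrM.
  by rewrite (ger0_norm (gauss_ge0 _ _)) ler_piMl ?sin_max.
(* Any open interval around xi serves, as the bound does not depend on the frequency. *)
have D := derivable_under_integral measurableT hI hi hd h0
  (integrable_mul_gauss s s0) hb.
have E := differentiation_under_integral measurableT hI hi hd h0
  (integrable_mul_gauss s s0) hb.
apply: DeriveDef => //; rewrite -derive1E E.
under eq_Rintegral do rewrite partial1of2E derive_val -mulN1r.
rewrite RintegralZl ?mulN1r//.
exact: integrable_sinM (integrable_mulx_gauss s s0).
Qed.

(** The transform F satisfies F' = - 2 s xi F and F(0) = 1, so
    exp (s xi^2) F(xi) is constant. *)
Theorem fourier_cos_gauss s xi : 0 < s ->
  \int[mu]_v (cos (xi * v) * gauss s v) = expR (- (s * xi ^+ 2)).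
Proof.
move=> s0.
pose F xi := \int[mu]_v (cos (xi * v) * gauss s v).
have dF x : is_derive x (1 : R) F (- (2 * s * x * F x)).
  by rewrite /F -gauss_fourier_parts//; exact: is_derive_gauss_fourier.
have dFe x : is_derive x (1 : R) (fun x => expR (s * x ^+ 2) * F x) 0.
  by apply: trigger_derive; rewrite /GRing.scale/=; ring.
have := @is_derive_0_is_cst R _ xi 0 dFe.
rewrite expr0n/= mulr0 expR0 mul1r {2}/F.
under [in RHS]eq_Rintegral do rewrite mul0r cos0 mul1r.
rewrite (Rintegral_gauss s s0) expRN => e.
by rewrite -[RHS]mulr1 -e mulKf// gt_eqF// expR_gt0.
Qed.

End gauss_fourier.

(** * Integrability on the plane *)

Section product_integrability.
Context {R : realType}.
Local Notation mu := (@lebesgue_measure R).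

Lemma measurable_integrable (f : R -> R) :
  mu.-integrable setT (EFin \o f) -> measurable_fun setT f.
Proof. by move=> /measurable_int/measurable_EFinP. Qed.

Lemma integral_normr_fin_num (f : R -> R) :
  mu.-integrable setT (EFin \o f) ->
  (\int[mu]_x (`|f x|)%:E)%E = (\int[mu]_x `|f x|)%:E.
Proof.
move=> /integrable_abse intf; rewrite /Rintegral fineK//.
exact: integrable_fin_num intf.
Qed.

Lemma integrable_tensor (f g : R -> R) :
  mu.-integrable setT (EFin \o f) -> mu.-integrable setT (EFin \o g) ->
  (mu \x mu)%E.-integrable setT (EFin \o (fun z : R * R => f z.1 * g z.2)).
Proof.
move=> intf intg.
have mf := measurable_integrable _ intf; have mg := measurable_integrable _ intg.
apply: integrable_prodP.
  by apply: measurable_funM; exact: measurableT_comp.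
under eq_integral => x _.
  under eq_integral do rewrite /= normrM EFinM.
  rewrite ge0_integralZl_EFin//; last first.
    by apply/measurable_EFinP; exact: measurableT_comp.
  rewrite integral_normr_fin_num//.
  over.
rewrite ge0_integralZr//; last 2 first.
  by apply/measurable_EFinP; exact: measurableT_comp.
  by rewrite lee_fin; exact: Rintegral_ge0.
by rewrite integral_normr_fin_num// -EFinM ltry.
Qed.

Lemma integrable_tensorM (k : R * R -> R) (f g : R -> R) :
  measurable_fun setT k -> (forall z, `|k z| <= 1) ->
  mu.-integrable setT (EFin \o f) -> mu.-integrable setT (EFin \o g) ->
  (mu \x mu)%E.-integrable setT
    (EFin \o (fun z : R * R => k z * (f z.1 * g z.2))).
Proof.
move=> mk k1 intf intg; have ifg := integrable_tensor _ _ intf intg.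
apply: le_integrable (ifg) => //.
  apply/measurable_EFinP/measurable_funM => //.
  by apply/measurable_EFinP; exact: measurable_int ifg.
by move=> z _ /=; rewrite lee_fin normrM ler_piMl.
Qed.

Lemma measurable_fun_sub : measurable_fun setT (fun z : R * R => z.1 - z.2).
Proof. by apply: measurable_funB. Qed.

Lemma integral_translate (c : R) (f : R -> \bar R) : measurable_fun setT f ->
  (\int[mu]_x f (x - c)%R = \int[mu]_x f x)%E.
Proof.
move=> mf; rewrite -[RHS](integral_reflect 0)//.
rewrite -[LHS](integral_reflect c); last first.
  by apply: measurableT_comp => //; exact: measurable_funB.
by apply: eq_integral => x _; congr f; lra.
Qed.

(** Integrating first in the variable that only f sees makes the shift
    disappear, and leaves the product of the two L^1 norms. *)
Lemma integrable_conv (f g : R -> R) :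
  mu.-integrable setT (EFin \o f) -> mu.-integrable setT (EFin \o g) ->
  (mu \x mu)%E.-integrable setT
    (EFin \o (fun z : R * R => f (z.1 - z.2) * g z.2)).
Proof.
move=> intf intg.
have mf := measurable_integrable _ intf; have mg := measurable_integrable _ intg.
have mfg : measurable_fun setT (fun z : R * R => f (z.1 - z.2) * g z.2).
  apply: measurable_funM; last exact: measurableT_comp.
  by apply: measurableT_comp => //; exact: measurable_fun_sub.
have mE : measurable_fun setT (EFin \o (fun z : R * R => f (z.1 - z.2) * g z.2)).
  exact/measurable_EFinP.
apply: ((@integrable21ltyP _ _ _ _ R mu mu _ mE).2).
under eq_integral => y _.
  under eq_integral do rewrite /= normrM EFinM.
  rewrite ge0_integralZr//; last first.
    apply/measurable_EFinP; apply: measurableT_comp => //.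
    by apply: measurableT_comp => //; exact: measurable_funB.
  rewrite (integral_translate y (fun x => `|f x|%:E)); last first.
    by apply/measurable_EFinP; exact: measurableT_comp.
  rewrite integral_normr_fin_num//.
  over.
rewrite ge0_integralZl_EFin//; last 2 first.
  by apply/measurable_EFinP; exact: measurableT_comp.
  exact: Rintegral_ge0.
by rewrite integral_normr_fin_num// -EFinM ltry.
Qed.

(** Taking the finite part of an extended real does not increase its modulus. *)
Lemma integrable_Rintegral1 (f : R * R -> R) :
  (mu \x mu)%E.-integrable setT (EFin \o f) ->
  mu.-integrable setT (EFin \o (fun x => \int[mu]_y f (x, y))).
Proof.
move=> intf; have iF := integrable_fubini_F intf.
have /integrableP[mF _] := iF.
apply: le_integrable (iF) => //.
  by apply/measurable_EFinP; exact: measurableT_comp.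
move=> x _; rewrite /Rintegral /fubini_F /=.
by case: integral => [r| |] //=; rewrite ?leey // normr0 leey.
Qed.

Lemma measurable_Rintegral2 (f : R * R -> R) :
  (mu \x mu)%E.-integrable setT (EFin \o f) ->
  measurable_fun setT (fun y => \int[mu]_x f (x, y)).
Proof.
move=> intf; have mG := measurable_fubini_G intf.
exact: measurableT_comp mG.
Qed.

End product_integrability.

(** * Injectivity of the Fourier transform *)

Section fourier_uniqueness.
Context {R : realType}.
Local Notation mu := (@lebesgue_measure R).

(** A Gaussian is, up to a constant, the transform of a Gaussian.  A convolution
    with it therefore depends on the other factor only through its transform. *)
Lemma gauss_cos_gauss (s y : R) : 0 < s ->
  gauss s y = gauss s 0 * \int[mu]_xi (cos (y * xi) * gauss (4 * s)^-1 xi).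
Proof.
move=> s0; rewrite fourier_cos_gauss ?invr_gt0; last lra.
rewrite /gauss expr0n/= mul0r oppr0 expR0 mulr1; congr (_ * expR (- _)).
by rewrite mulrC.
Qed.

(** Expanding the Gaussian as an integral of cos (xi (x - v)) and exchanging the
    integrals leaves the sine and cosine transforms of h. *)
Lemma gauss_conv_eq0 (h : R -> R) (s x : R) : 0 < s ->
  mu.-integrable setT (EFin \o h) ->
  (forall xi, \int[mu]_v (cos (xi * v) * h v) = 0) ->
  (forall xi, \int[mu]_v (sin (xi * v) * h v) = 0) ->
  \int[mu]_v (gauss s (x - v) * h v) = 0.
Proof.
move=> s0 ih hc hs; set g := gauss (4 * s)^-1.
have ig : mu.-integrable setT (EFin \o g) by exact: integrable_gauss.
pose k (z : R * R) := cos ((x - z.1) * z.2).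
have mk : measurable_fun setT k.
  apply: measurableT_comp.
    by apply: continuous_measurable_fun; exact: continuous_cos.
  by apply: measurable_funM => //; exact: measurable_funB.
have ik := integrable_tensorM k h g mk (fun z => cos_max _) ih ig.
have F := Rintegral_Fubini _ ik.
transitivity (gauss s 0 * \int[mu]_v \int[mu]_xi (k (v, xi) * (h v * g xi))).
  rewrite -[RHS](RintegralZl _ measurableT (integrable_Rintegral1 _ ik)).
  apply: eq_Rintegral => v _.
  rewrite (gauss_cos_gauss s (x - v) s0).
  rewrite -/g.
  rewrite -mulrA.
  congr (_ * _).
  rewrite mulrC -[LHS](RintegralZl _ measurableT (integrable_cosM (x - v) _ ig)).
  by apply: eq_Rintegral => xi _; rewrite /k/=; ring.
suff E xi : \int[mu]_v (k (v, xi) * (h v * g xi)) = 0.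
  rewrite F; under eq_Rintegral do rewrite /= E.
  by rewrite /Rintegral integral0/= mulr0.
(* The addition formula splits the inner integral into the two transforms of h. *)
have i1 : mu.-integrable setT
    (EFin \o (fun v => (cos (x * xi) * g xi) * (cos (xi * v) * h v))).
  exact: (integrableZl measurableT) (integrable_cosM xi _ ih).
have i2 : mu.-integrable setT
    (EFin \o (fun v => (sin (x * xi) * g xi) * (sin (xi * v) * h v))).
  exact: (integrableZl measurableT) (integrable_sinM xi _ ih).
transitivity (\int[mu]_v (cos (x * xi) * g xi * (cos (xi * v) * h v) +
    sin (x * xi) * g xi * (sin (xi * v) * h v))).
  apply: eq_Rintegral => v _.
  by rewrite /k/= mulrBl cosB (mulrC v); ring.
rewrite (RintegralD measurableT i1 i2).
rewrite (RintegralZl _ measurableT (integrable_cosM xi _ ih)).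
by rewrite (RintegralZl _ measurableT (integrable_sinM xi _ ih)) hc hs !mulr0 addr0.
Qed.

Lemma Rintegral_dominated_cvg (f_ : nat -> R -> R) (f g : R -> R) :
  (forall n, measurable_fun setT (f_ n)) -> measurable_fun setT f ->
  {ae mu, forall v, f_ n v @[n --> \oo] --> f v} ->
  mu.-integrable setT (EFin \o g) -> (forall n v, `|f_ n v| <= g v) ->
  \int[mu]_v f_ n v @[n --> \oo] --> \int[mu]_v f v.
Proof.
move=> mf_ mf ff ig fg.
have [| | | | |i1 _ i2] := @dominated_convergence _ _ _ mu _ measurableT
  (fun n => EFin \o f_ n) (EFin \o f) (EFin \o g).
- by move=> n; apply/measurable_EFinP; exact: mf_.
- exact/measurable_EFinP.
- apply: (@filterS _ _ (ae_filter_ringOfSetsType mu) _ _ _ ff) => v fv _.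
  by apply: cvg_EFin; [exact: nearW|exact: fv].
- exact: ig.
- by apply: aeW => v n _ /=; rewrite lee_fin.
- by apply: fine_cvg; rewrite fineK//; exact: integrable_fin_num.
Qed.

Lemma Rintegral_gauss_translate (s v : R) : 0 < s ->
  \int[mu]_u gauss s (u - v) = 1.
Proof.
move=> s0; rewrite -[RHS](Rintegral_gauss s s0).
rewrite -[RHS](Rintegral_reflect v _ (measurable_gauss s)).
by apply: eq_Rintegral => u _; rewrite -gauss_even opprB.
Qed.

Lemma integrable_translate (f : R -> R) (v : R) :
  mu.-integrable setT (EFin \o f) ->
  mu.-integrable setT (EFin \o (fun u => f (u - v))).
Proof.
move=> /(integrable_reflect 0)/(integrable_reflect v).
by apply: eq_integrable => // u _ /=; congr EFin; congr f; lra.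
Qed.

(** The indicators at u and v differ only if x separates u from v, and then
    |u - v| >= |x - v|; the exponential split off by [gauss_factor] is thus at
    most its value at x - v. *)
Lemma gauss_halfline_close (s x v : R) : 0 < s ->
  `|\int[mu]_u (\1_`]-oo, x] u * gauss s (u - v)) - \1_`]-oo, x] v| <=
  Num.sqrt 2 * expR (- ((x - v) ^+ 2 / (8 * s))).
Proof.
move=> s0; set phi := \1_`]-oo, x] : R -> R.
have phiE u : phi u = (u <= x)%R%:R by rewrite /phi indicE mem_setE in_itv.
have mphi : measurable_fun setT phi by exact: measurable_indic.
have phi1 u : `|phi u| <= 1 by rewrite phiE normr_nat lern1 leq_b1.
have ig := integrable_translate _ v (integrable_gauss s).
have ig2 := integrable_translate _ v (integrable_gauss (2 * s)).
have ipg := integrableM_le1 phi _ mphi phi1 ig.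
have ipgv : mu.-integrable setT (EFin \o (fun u => phi v * gauss s (u - v))).
  exact: (integrableZl measurableT) ig.
have -> : phi v = \int[mu]_u (phi v * gauss s (u - v)).
  by rewrite (RintegralZl _ measurableT ig) Rintegral_gauss_translate// mulr1.
rewrite -(RintegralB measurableT ipg ipgv).
have id : mu.-integrable setT (EFin \o
    (fun u => phi u * gauss s (u - v) - phi v * gauss s (u - v))).
  by have := integrableB measurableT ipg ipgv.
apply: le_trans (le_normr_Rintegral measurableT id) _.
set c := Num.sqrt 2 * _.
rewrite -[leRHS]mulr1 -(Rintegral_gauss_translate (2 * s) v); last lra.
rewrite -(RintegralZl c measurableT ig2).
apply: le_Rintegral => //.
- by have := integrable_norm id.
- exact: (integrableZl measurableT) ig2.
move=> u _; rewrite -mulrBl normrM (ger0_norm (gauss_ge0 _ _)).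
have c0 : 0 <= c by rewrite mulr_ge0 ?sqrtr_ge0 ?expR_ge0.
rewrite gauss_factor// mulrA ler_wpM2r ?gauss_ge0// mulrCA.
apply: ler_wpM2l; first exact: sqrtr_ge0.
have key : (u <= x) != (v <= x) -> (x - v) ^+ 2 <= (u - v) ^+ 2.
  by case: (leP u x); case: (leP v x) => //= ? ? _; nra.
rewrite !phiE; case: (eqVneq (u <= x) (v <= x)) => [->|/key].
  by rewrite subrr normr0 mul0r expR_ge0.
move=> h; apply: le_trans (_ : 1 * expR (- ((u - v) ^+ 2 / (8 * s))) <= _).
  apply: ler_wpM2r; first exact: expR_ge0.
  by case: (u <= x); case: (v <= x); rewrite ?subrr ?subr0 ?sub0r ?normrN ?normr1 ?normr0.
by rewrite mul1r ler_expR lerN2 ler_pM2r// invr_gt0; lra.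
Qed.

(** The indicator of the half-line, smoothed by G_s with s = 1 / (n+1),
    has integral 0 against h by [gauss_conv_eq0], and it converges boundedly to
    the indicator except at the end point x. *)
Lemma Rintegral_halfline_eq0 (h : R -> R) (x : R) :
  mu.-integrable setT (EFin \o h) ->
  (forall xi, \int[mu]_v (cos (xi * v) * h v) = 0) ->
  (forall xi, \int[mu]_v (sin (xi * v) * h v) = 0) ->
  \int[mu]_v (\1_`]-oo, x] v * h v) = 0.
Proof.
move=> ih hc hs; set phi := \1_`]-oo, x] : R -> R.
have phi1 u : `|phi u| <= 1 by rewrite /phi indicE normr_nat lern1 leq_b1.
have mphi : measurable_fun setT phi by exact: measurable_indic.
pose s_ n : R := n.+1%:R^-1.
have s0 n : 0 < s_ n by rewrite invr_gt0.
pose Phi n v := \int[mu]_u (phi u * gauss (s_ n) (u - v)).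
have ik n : (mu \x mu)%E.-integrable setT (EFin \o (fun z : R * R =>
    phi z.1 * (gauss (s_ n) (z.1 - z.2) * h z.2))).
  have ic := integrable_conv _ _ (integrable_gauss (s_ n)) ih.
  apply: le_integrable (ic) => //.
    apply/measurable_EFinP/measurable_funM; first exact: measurableT_comp.
    by apply/measurable_EFinP; exact: measurable_int ic.
  by move=> z _ /=; rewrite lee_fin normrM ler_piMl.
have ipg n v : mu.-integrable setT (EFin \o (fun u => phi u * gauss (s_ n) (u - v))).
  apply: integrableM_le1 => //.
  exact: integrable_translate (integrable_gauss _).
have PhiE n v : \int[mu]_u (phi u * (gauss (s_ n) (u - v) * h v)) = Phi n v * h v.
  rewrite mulrC -(RintegralZl _ measurableT (ipg n v)).
  by apply: eq_Rintegral => u _; ring.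
have Phi0 n : \int[mu]_v (Phi n v * h v) = 0.
  transitivity (\int[mu]_v \int[mu]_u (phi u * (gauss (s_ n) (u - v) * h v))).
    by apply: eq_Rintegral => v _; rewrite PhiE.
  have F := Rintegral_Fubini _ (ik n); rewrite /= in F; rewrite -F.
  transitivity (\int[mu]_u (0 : R)); last by rewrite /Rintegral integral0.
  apply: eq_Rintegral => u _.
  have ig : mu.-integrable setT (EFin \o (fun v => gauss (s_ n) (u - v) * h v)).
    have ih' : mu.-integrable setT (EFin \o (fun v => gauss (s_ n) 0 * h v)).
      exact: (integrableZl measurableT) ih.
    apply: le_integrable (ih') => //.
      apply/measurable_EFinP/measurable_funM; last exact: measurable_integrable.
      apply: measurableT_comp; first exact: measurable_gauss.
      exact: measurable_funB.
    move=> v _ /=; rewrite lee_fin !normrM ler_wpM2r//.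
    rewrite !ger0_norm ?gauss_ge0// /gauss.
    apply: ler_wpM2l; first by rewrite invr_ge0 sqrtr_ge0.
    rewrite ler_expR lerN2 expr0n/= mul0r divr_ge0 ?sqr_ge0//.
    by rewrite mulr_ge0// ltW.
  by rewrite (RintegralZl _ measurableT ig) gauss_conv_eq0// mulr0.
have close n v : `|Phi n v - phi v| <=
    Num.sqrt 2 * expR (- ((x - v) ^+ 2 / (8 * s_ n))).
  exact: gauss_halfline_close.
have Phi3 n v : `|Phi n v| <= 3.
  have s2 : Num.sqrt 2 ^+ 2 = 2 :> R by rewrite sqr_sqrtr.
  have s20 : 0 <= Num.sqrt 2 :> R by exact: sqrtr_ge0.
  have e1 : expR (- ((x - v) ^+ 2 / (8 * s_ n))) <= 1.
    rewrite -[leRHS]expR0 ler_expR oppr_le0 divr_ge0 ?sqr_ge0//.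
    by rewrite mulr_ge0// ltW.
  have e0 := expR_ge0 (- ((x - v) ^+ 2 / (8 * s_ n))).
  rewrite -(subrK (phi v) (Phi n v)); apply: le_trans (ler_normD _ _) _.
  have := close n v; have := phi1 v; nra.
have : \int[mu]_v (Phi n v * h v) @[n --> \oo] --> \int[mu]_v (phi v * h v).
  apply: (Rintegral_dominated_cvg _ _ (fun v => 3 * `|h v|)).
  - move=> n; have := measurable_Rintegral2 _ (ik n).
    by apply: eq_measurable_fun => v _; rewrite /= PhiE.
  - apply: measurable_funM => //; exact: measurable_integrable.
  - exists [set x]; split; [exact: measurable_set1|exact: lebesgue_measure_set1|].
    move=> v /= nc; apply: contrapT => vx; apply: nc.
    have cn : (x - v) ^+ 2 / (8 * s_ n) @[n --> \oo] --> +oo.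
      have -> : (fun n => (x - v) ^+ 2 / (8 * s_ n)) =
          (fun n => (x - v) ^+ 2 / 8 * n.+1%:R).
        by apply/funext => n; rewrite invfM invrK mulrA.
      have xv0 : 0 < (x - v) ^+ 2 / 8.
        rewrite divr_gt0// exprn_even_gt0//= subr_eq0.
        by apply/eqP => xv; exact: vx.
      have nS : (n.+1%:R : R) @[n --> \oo] --> +oo.
        by rewrite (cvg_shiftS (fun n => n%:R : R)); exact: cvgr_idn.
      exact: (cvg_comp _ _ nS (gt0_cvgMry xv0 cvg_id)).
    have cv : Num.sqrt 2 * expR (- ((x - v) ^+ 2 / (8 * s_ n)))
        @[n --> \oo] --> (0 : R).
      rewrite -(mulr0 (Num.sqrt 2)); apply: cvgMr.
      exact: (cvg_comp _ _ cn (@cvgr_expR R)).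
    have cP : Phi n v - phi v @[n --> \oo] --> (0 : R).
      apply: norm_cvg0; apply: (squeeze_cvgr _ (cvg_cst 0) cv).
      by apply: nearW => n; rewrite normr_ge0; exact: close.
    by apply: cvgMl; apply/subr_cvg0.
  - exact: (integrableZl measurableT) (integrable_norm ih).
  - by move=> n v; rewrite normrM ler_wpM2r.
rewrite (_ : (fun n => _) = cst 0); last by apply/funext => n; rewrite Phi0.
by move=> /(cvg_unique _ (cvg_cst _)) <-.
Qed.

(** The primitive of h vanishes by [Rintegral_halfline_eq0], and h is almost
    everywhere the derivative of its primitive. *)
Theorem fourier_injective (h : R -> R) :
  mu.-integrable setT (EFin \o h) ->
  (forall xi, \int[mu]_v (cos (xi * v) * h v) = 0) ->
  (forall xi, \int[mu]_v (sin (xi * v) * h v) = 0) ->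
  {ae mu, forall v, h v = 0}.
Proof.
move=> ih hc hs.
have iy (y : R) : mu.-integrable `]-oo, y] (EFin \o h).
  exact: integrableS ih.
have lh : locally_integrable setT h.
  by have := @integrable_locally R h _ measurableT ih; rewrite patch_setT.
have := @FTC1Ny R h iy lh.
apply: (@filterS _ _ (ae_filter_ringOfSetsType mu)) => v [_ <-].
rewrite (_ : (fun _ => _) = cst 0) ?derive1_cst//.
apply/funext => y; rewrite -[RHS](Rintegral_halfline_eq0 h y ih hc hs).
rewrite Rintegral_mkcond; apply: eq_Rintegral => u _.
by rewrite patchE indicE; case: ifP; rewrite ?mul1r ?mul0r.
Qed.

End fourier_uniqueness.

(** * Gamma integrals *)

Section halfline.
Context {R : realType}.
Local Notation mu := (@lebesgue_measure R).

Lemma integral_halfline_derivative (F f : R -> R) (l : R) :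
  (forall x, is_derive x (1 : R) F (f x)) -> continuous f ->
  (forall x, 0 <= x -> 0 <= f x) -> F x @[x --> +oo] --> l ->
  (\int[mu]_(x in `[0%R, +oo[) (f x)%:E = (l - F 0)%:E)%E.
Proof.
move=> dF cf f0 Fl; have cF := is_derive_continuous _ _ dF.
have dF0 x : 0 < x -> derivable F x 1 by have [] := dF x.
have F'f : {in `]0, +oo[, F^`()%classic =1 f}.
  by move=> x _; rewrite derive1E; have [] := dF x.
have Fr : F x @[x --> 0^'+] --> F 0 by exact/cvg_at_right_filter/cF.
by rewrite (ge0_continuous_FTC2y f0 (continuous_subspaceT cf) Fl dF0 Fr F'f).
Qed.

(** Since exp y >= y^(n+1) / (n+1)!, the product is O(1 / x). *)
Lemma exprn_expRN_cvgy (c : R) (n : nat) : 0 < c ->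
  x ^+ n * expR (- (c * x)) @[x --> +oo] --> 0.
Proof.
move=> c0; pose K : R := n.+1`!%:R / c ^+ n.+1.
have cv : K * x^-1 @[x --> +oo] --> 0.
  rewrite -(mulr0 K); apply: cvgMr.
  have pos : \forall x \near +oo, 0 < (x : R) by exact: nbhs_pinfty_gt.
  by apply: (gtr0_cvgV0 pos).2; exact: cvg_id.
have : \forall x \near +oo, 0 <= x ^+ n * expR (- (c * x)) <= K * x^-1.
  near=> x; have x0 : 0 < x by near: x; exact: nbhs_pinfty_gt.
  rewrite mulr_ge0 ?exprn_ge0 ?expR_ge0 ?(ltW x0)//=.
  have cx0 : 0 < c * x by rewrite mulr_gt0.
  have := expR_ge1Dxn n (ltW cx0).
  rewrite expRN ler_pdivrMr ?expR_gt0// => h.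
  have {}h : (c * x) ^+ n.+1 / n.+1`!%:R <= expR (c * x) by lra.
  have K0 : 0 < K * x^-1 by rewrite mulr_gt0 ?invr_gt0// divr_gt0 ?exprn_gt0// ltr0n fact_gt0.
  rewrite -(ler_pM2l K0) in h; apply: le_trans h.
  have A0 : c ^+ n.+1 != 0 by rewrite gt_eqF// exprn_gt0.
  have B0 : n.+1`!%:R != 0 :> R by rewrite pnatr_eq0 -lt0n fact_gt0.
  rewrite /K exprMn (exprS x); move: A0 B0 (gt_eqF x0).
  move: (c ^+ n.+1) (n.+1`!%:R) (x ^+ n) => A B C A0 B0 /negbT xn0.
  by rewrite le_eqVlt; apply/orP; left; apply/eqP; field; rewrite xn0 A0 B0.
move=> /squeeze_cvgr; apply => //; exact: cvg_cst.
Unshelve. all: end_near. Qed.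

(** A primitive vanishing at infinity is built by induction on n, as in an
    integration by parts; the integrand being nonnegative, no integrability has
    to be known beforehand. *)
Lemma integral_exprn_expRN (c : R) (n : nat) : 0 < c ->
  (\int[mu]_(s in `[0%R, +oo[) (s ^+ n * expR (- (c * s)))%:E =
   (n`!%:R / c ^+ n.+1)%:E)%E.
Proof.
move=> c0; have cn0 : c != 0 by rewrite gt_eqF.
suff [F [dF F0 Fy]] : exists F : R -> R,
    [/\ forall x, is_derive x (1 : R) F (x ^+ n * expR (- (c * x))),
        F 0 = - (n`!%:R / c ^+ n.+1) & F x @[x --> +oo] --> 0].
  rewrite (integral_halfline_derivative F _ 0)//; first by rewrite F0 sub0r opprK.
    move=> x; apply: cvgM; first exact: exprn_continuous.
    apply: (@is_derive_continuous R (fun x => expR (- (c * x)))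
      (fun x => - (c * expR (- (c * x))))) => y.
    by apply: trigger_derive; rewrite /GRing.scale/=; ring.
  by move=> x x0; rewrite mulr_ge0 ?exprn_ge0 ?expR_ge0.
elim: n => [|n [F [dF F0 Fy]]].
  exists (fun x => - (c^-1 * expR (- (c * x)))); split.
  - move=> x; rewrite expr0 mul1r.
    by apply: trigger_derive; rewrite /GRing.scale/=; field.
  - by rewrite mulr0 oppr0 expR0 mulr1 expr1 fact0 div1r.
  - rewrite -oppr0 -(mulr0 c^-1); apply: cvgN; apply: cvgMr.
    have := exprn_expRN_cvgy c 0 c0.
    by under eq_fun do rewrite expr0 mul1r.
exists (fun x => - (c^-1 * (x ^+ n.+1 * expR (- (c * x)))) + (n.+1%:R / c) * F x); split.
- have dX y : is_derive y (1 : R) (fun x : R => x ^+ n.+1) (n.+1%:R * y ^+ n).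
    have := @is_deriveX R R id n.+1 y 1 1 (is_derive_id y 1).
    rewrite (_ : id ^+ n.+1 = (fun x : R => x ^+ n.+1)).
      by rewrite /GRing.scale/= mulr1.
    by apply/funext => z; rewrite exprfctE.
  move=> x; apply: trigger_derive; rewrite /GRing.scale/= exprS.
  by field.
- rewrite F0 expr0n/= mul0r mulr0 oppr0 add0r factS natrM [c ^+ n.+2]exprS.
  by field; rewrite cn0 expf_neq0.
- rewrite -(addr0 0); apply: cvgD.
    rewrite -oppr0 -(mulr0 c^-1); apply: cvgN; apply: cvgMr.
    exact: exprn_expRN_cvgy.
  by rewrite -(mulr0 (n.+1%:R / c)); apply: cvgMr.
Qed.

End halfline.

(** * The Fourier transform of the Laplace density *)

Section rosenau_fourier.
Context {R : realType}.
Local Notation mu := (@lebesgue_measure R).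

Lemma continuous_rosenau_kernel (eps : R) : continuous (rosenau_kernel eps).
Proof.
move=> v; apply: cvgM; first exact: cvg_cst.
apply: (@continuous_comp _ _ _ (fun v : R => - (`|v| / eps)) expR).
  by apply: cvgN; apply: cvgM; [exact: norm_continuous|exact: cvg_cst].
exact: continuous_expR.
Qed.

Lemma rosenau_kernel_ge0 (eps v : R) : 0 < eps -> 0 <= rosenau_kernel eps v.
Proof.
by move=> e0; rewrite mulr_ge0 ?expR_ge0// invr_ge0 mulr_ge0// ltW.
Qed.

(** With 1 + cos instead of cos the integrand is nonnegative and even, so
    that integrability comes out of the computation: it reduces to the half-line
    and to an explicit primitive.  The case xi = 0 gives the total mass. *)
Lemma integral_rosenau_cos (eps xi : R) : 0 < eps ->
  (\int[mu]_v ((1 + cos (xi * v)) * rosenau_kernel eps v)%:E =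
   (1 + (1 + (eps * xi) ^+ 2)^-1)%:E)%E.
Proof.
move=> e0; have en0 : eps != 0 by rewrite gt_eqF.
have D0 : 1 + (eps * xi) ^+ 2 != 0.
  by rewrite gt_eqF// ltr_pwDl// sqr_ge0.
pose F v := (2 * eps)^-1 * expR (- (v / eps)) *
  (- eps + eps * (eps * xi * sin (xi * v) - cos (xi * v)) / (1 + (eps * xi) ^+ 2)).
pose f v := (1 + cos (xi * v)) * ((2 * eps)^-1 * expR (- (v / eps))).
have cosxi v : is_derive v (1 : R) (fun v => cos (xi * v)) (- (xi * sin (xi * v))).
  by apply: trigger_derive; rewrite /GRing.scale/=; ring.
have dF v : is_derive v (1 : R) F (f v).
  by rewrite /F /f; apply: trigger_derive; rewrite /GRing.scale/=; field; rewrite en0.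
have cf : continuous f.
  by rewrite /f; apply: derivable_continuous => v; exact: ex_derive.
have cos1 v : 0 <= 1 + cos (xi * v).
  by have := cos_geN1 (xi * v); lra.
have f0 v : 0 <= v -> 0 <= f v.
  by move=> _; rewrite mulr_ge0// mulr_ge0 ?expR_ge0// invr_ge0; lra.
have Fy : F v @[v --> +oo] --> 0.
  have ey : expR (- (v / eps)) @[v --> +oo] --> 0.
    have vy : v / eps @[v --> +oo] --> +oo.
      have ie0 : 0 < eps^-1 by rewrite invr_gt0.
      exact: (gt0_cvgMly ie0 cvg_id).
    exact: (cvg_comp _ _ vy (@cvgr_expR R)).
  (* K bounds everything in F but the exponential, by |sin|, |cos| <= 1. *)
  pose K := (2 * eps)^-1 * (eps + eps * (`|eps * xi| + 1)).
  have Ky : K * expR (- (v / eps)) @[v --> +oo] --> 0.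
    by rewrite -(mulr0 K); apply: cvgMr.
  apply: norm_cvg0; apply: (squeeze_cvgr _ (cvg_cst 0) Ky).
  apply: nearW => v; rewrite normr_ge0 /F !normrM (ger0_norm (expR_ge0 _)).
  rewrite /K mulrAC ler_wpM2r ?expR_ge0//.
  have e2 : 0 < (2 * eps)^-1 by rewrite invr_gt0; lra.
  rewrite (gtr0_norm e2) ler_wpM2l ?(ltW e2)//.
  apply: le_trans (ler_normD _ _) _; rewrite normrN (gtr0_norm e0) lerD2l.
  rewrite normrM normfV (gtr0_norm (_ : 0 < 1 + (eps * xi) ^+ 2)); last first.
    by rewrite ltr_pwDl// sqr_ge0.
  rewrite ler_pdivrMr; last by rewrite ltr_pwDl// sqr_ge0.
  rewrite normrM (gtr0_norm e0) -[leRHS]mulrA ler_pM2l//.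
  apply: le_trans (_ : `|eps * xi| + 1 <= _); last first.
    by rewrite ler_peMr ?addr_ge0// lerDl sqr_ge0.
  apply: le_trans (ler_normB _ _) _; rewrite normrM lerD ?cos_max//.
  by rewrite ler_piMr// sin_max.
rewrite ge0_symfun_integralT; first last.
- by move=> v /=; rewrite /rosenau_kernel normrN mulrN cosN.
- move=> v; apply: cvgM; last exact: continuous_rosenau_kernel.
  apply: cvgD; first exact: cvg_cst.
  by apply: derivable_continuous => u; exact: ex_derive.
- by move=> v; rewrite mulr_ge0 ?rosenau_kernel_ge0.
rewrite -set_itvcy (_ : integral _ _ _ = (\int[mu]_(v in `[0%R, +oo[) (f v)%:E)%E); last first.
  apply: eq_integral => v; rewrite inE/= in_itv/= andbT => v0.
  by rewrite /rosenau_kernel ger0_norm.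
rewrite (integral_halfline_derivative F f 0 dF cf f0 Fy) -EFinM.
congr EFin; rewrite /F mul0r oppr0 expR0 !mulr0 sin0 cos0.
by field; rewrite D0 en0.
Qed.

Lemma integral_rosenau_kernel (eps : R) : 0 < eps ->
  (\int[mu]_v (rosenau_kernel eps v)%:E = 1)%E.
Proof.
move=> e0; have := integral_rosenau_cos eps 0 e0.
under eq_integral do rewrite mul0r cos0 EFinM.
rewrite ge0_integralZl_EFin//; last 2 first.
- by move=> v _; rewrite lee_fin rosenau_kernel_ge0.
- apply/measurable_EFinP.
  by apply: continuous_measurable_fun; exact: continuous_rosenau_kernel.
rewrite mulr0 expr0n/= addr0 invr1.
set I := integral _ _ _; move: I => [r| |]//=.
- by rewrite -EFinM => -[] h; congr EFin; lra.
- by rewrite mulr_infty gtr0_sg// mul1e.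
- by rewrite mulr_infty gtr0_sg// mul1e.
Qed.

Lemma integrable_rosenau_kernel (eps : R) : 0 < eps ->
  mu.-integrable setT (EFin \o rosenau_kernel eps).
Proof.
move=> e0; apply/integrableP; split.
  apply/measurable_EFinP.
  by apply: continuous_measurable_fun; exact: continuous_rosenau_kernel.
rewrite (_ : integral _ _ _ = (\int[mu]_v (rosenau_kernel eps v)%:E)%E).
  by rewrite integral_rosenau_kernel// ltry.
by apply: eq_integral => v _ /=; rewrite ger0_norm// rosenau_kernel_ge0.
Qed.

Lemma fourier_cos_rosenau_kernel (eps xi : R) : 0 < eps ->
  \int[mu]_v (cos (xi * v) * rosenau_kernel eps v) = (1 + (eps * xi) ^+ 2)^-1.
Proof.
move=> e0; have ir := integrable_rosenau_kernel eps e0.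
have := integral_rosenau_cos eps xi e0.
rewrite (_ : integral _ _ _ = (\int[mu]_v (rosenau_kernel eps v +
    cos (xi * v) * rosenau_kernel eps v)%:E)%E); last first.
  by apply: eq_integral => v _; rewrite mulrDl mul1r.
move=> /(congr1 fine) /=.
have := RintegralD measurableT ir (integrable_cosM xi _ ir).
rewrite /Rintegral /= integral_rosenau_kernel// => -> /=; lra.
Qed.

Lemma Rintegral_sin_even (f : R -> R) (xi : R) :
  mu.-integrable setT (EFin \o f) -> (forall v, f (- v) = f v) ->
  \int[mu]_v (sin (xi * v) * f v) = 0.
Proof.
move=> intf fN; apply: Rintegral_odd; first exact: integrable_sinM.
by move=> v; rewrite mulrN sinN fN mulNr.
Qed.

End rosenau_fourier.

(** * The regularized kernel in the Fourier variable *)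

Section complex_fourier.
Local Open Scope complex_scope.
Context {R : realType}.
Local Notation mu := (@lebesgue_measure R).

Lemma cexpE (x y : R) :
  cexp (x +i* y) = (expR x * cos y) +i* (expR x * sin y).
Proof.
rewrite /cexp /=; apply/eqP; rewrite eq_complex /=.
by apply/andP; split; apply/eqP; ring.
Qed.

Lemma fourierE (f : R -> R) (xi : R) : mu.-integrable setT (EFin \o f) ->
  fourier f xi = (\int[mu]_v (cos (xi * v) * f v)) +i*
                 - (\int[mu]_v (sin (xi * v) * f v)).
Proof.
move=> intf; rewrite /fourier /cintegral.
have E v : cexp (- 'i * xi%:C * v%:C) = cos (xi * v) -i* sin (xi * v).
  rewrite (_ : - 'i * xi%:C * v%:C = 0 +i* - (xi * v)); last first.
    by apply/eqP; rewrite eq_complex /=; apply/andP; split; apply/eqP; ring.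
  by rewrite cexpE expR0 !mul1r cosN sinN.
congr (_ +i* _).
- apply: eq_Rintegral => v _; rewrite E /=; ring.
- rewrite -[RHS]mulN1r -[RHS](RintegralZl (-1) measurableT (integrable_sinM xi _ intf)).
  by apply: eq_Rintegral => v _; rewrite E /=; ring.
Qed.

Lemma fourier_rosenau_kernel (eps xi : R) : 0 < eps ->
  fourier (rosenau_kernel eps) xi = ((1 + (eps * xi) ^+ 2)^-1)%:C.
Proof.
move=> e0; rewrite fourierE; last exact: integrable_rosenau_kernel.
rewrite fourier_cos_rosenau_kernel// Rintegral_sin_even ?oppr0//.
- exact: integrable_rosenau_kernel.
- by move=> v; rewrite /rosenau_kernel normrN.
Qed.

(** The Laplace transform of the law called [mixing_density b T] below, as
    [laplace_mixing_density] shows.  Writing b / (b + u), the Laplace transform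
    of the exponential law of rate b, for the Fourier transform b / (b + xi^2) of
    the Laplace density turns the regularized kernel into this function of
    u = xi^2. *)
Definition mixing_laplace (b T u : R) : R :=
  expR (- (b * T)) * (expR (b * T * (b / (b + u))) - (1 - b / (b + u))).

Lemma reg_kernel_hatE (lambda eps t xi : R) : 0 < eps ->
  reg_kernel_hat lambda eps t xi =
  (mixing_laplace (eps ^- 2) (lambda * t) (xi ^+ 2))%:C.
Proof.
move=> e0; rewrite /reg_kernel_hat fourier_rosenau_kernel//.
have en0 : eps != 0 by rewrite gt_eqF.
have D0 : 1 + (eps * xi) ^+ 2 != 0 by rewrite gt_eqF// ltr_pwDl// sqr_ge0.
have -> : (1 + (eps * xi) ^+ 2)^-1 = eps ^- 2 / (eps ^- 2 + xi ^+ 2) :> R.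
  by field; rewrite en0 mulrC D0.
rewrite /mixing_laplace; set m := _ / _; rewrite (mulrC (eps ^- 2)).
set a := _ / _.
rewrite (_ : - a%:C = (- a) +i* 0); last first.
  by apply/eqP; rewrite eq_complex /= oppr0 !eqxx.
rewrite (_ : m%:C * a%:C = (a * m) +i* 0); last first.
  by apply/eqP; rewrite eq_complex /=; apply/andP; split; apply/eqP; ring.
rewrite !cexpE cos0 sin0.
by apply/eqP; rewrite eq_complex /=; apply/andP; split; apply/eqP; ring.
Qed.

End complex_fourier.

(** * The density of the subordinator *)

Section mixing_density.
Context {R : realType}.
Local Notation mu := (@lebesgue_measure R).

(** The series sums to sqrt (k / s) I_1(2 sqrt (k s)), with I_1 the modified
    Bessel function; up to exponential factors it is the density of a compound
    Poisson law with exponential jumps. *)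
Definition bessel_coeff (k s : R) (n : nat) : R :=
  k ^+ n.+1 * s ^+ n / (n.+1`! * n`!)%:R.

Definition bessel_series (k s : R) : R := limn (series (bessel_coeff k s)).

Lemma bessel_coeff_ge0 k s n : 0 <= k -> 0 <= s -> 0 <= bessel_coeff k s n.
Proof.
by move=> k0 s0; rewrite /bessel_coeff !mulr_ge0 ?invr_ge0 ?exprn_ge0 ?ler0n.
Qed.

Lemma nneseries_EFin (u : nat -> R) : cvgn (series u) ->
  (\sum_(0 <= n <oo) (u n)%:E = (limn (series u))%:E)%E.
Proof.
move=> cu; rewrite -EFin_lim//; congr (limn _); apply/funext => n /=.
by rewrite /series/= sumEFin.
Qed.

(** Comparison with k exp (k s), dropping the factor 1 / (n+1)!. *)
Lemma is_cvg_bessel_series k s : 0 <= k -> 0 <= s ->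
  cvgn (series (bessel_coeff k s)).
Proof.
move=> k0 s0; pose w n := k * exp_coeff (k * s) n.
have cw : cvgn (series w).
  by apply: is_cvg_seriesZ; exact: is_cvg_series_exp_coeff.
apply: series_le_cvg cw => n; first exact: bessel_coeff_ge0.
  by rewrite mulr_ge0// exp_coeff_ge0// mulr_ge0.
rewrite /w /bessel_coeff /exp_coeff/= exprS exprMn natrM invfM !mulrA.
have n0 : 0 < n`!%:R :> R by rewrite ltr0n fact_gt0.
apply: ler_pM => //; rewrite ?mulr_ge0 ?exprn_ge0 ?invr_ge0 ?ler0n//.
rewrite ler_piMr ?mulr_ge0 ?exprn_ge0//.
by rewrite invf_le1 ?ler1n ?fact_gt0// ltr0n fact_gt0.
Qed.

Lemma bessel_seriesE k s : 0 <= k -> 0 <= s ->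
  (\sum_(0 <= n <oo) (bessel_coeff k s n)%:E = (bessel_series k s)%:E)%E.
Proof. by move=> k0 s0; rewrite nneseries_EFin//; exact: is_cvg_bessel_series. Qed.

Lemma bessel_series_ge0 k s : 0 <= k -> 0 <= s -> 0 <= bessel_series k s.
Proof.
move=> k0 s0; rewrite -lee_fin -bessel_seriesE//.
by apply: nneseries_ge0 => n _ _; rewrite lee_fin bessel_coeff_ge0.
Qed.

Lemma series_exp_coeffS (x : R) :
  (\sum_(0 <= n <oo) (exp_coeff x n.+1)%:E = (expR x - 1)%:E)%E.
Proof.
have E : series (fun n => exp_coeff x n.+1) = (fun n => series (exp_coeff x) n.+1 - 1).
  apply/funext => n; rewrite /series/= big_nat_recl//= /exp_coeff/= expr0 fact0 divr1.
  by rewrite addrAC subrr add0r.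
have c : series (fun n => exp_coeff x n.+1) @ \oo --> expR x - 1.
  rewrite E; apply: cvgB; last exact: cvg_cst.
  rewrite (cvg_shiftS (series (exp_coeff x))).
  exact: is_cvg_series_exp_coeff.
rewrite nneseries_EFin; last by apply/cvg_ex; exists (expR x - 1).
by congr EFin; apply/cvg_lim.
Qed.

(** Term by term, the gamma integrals turn the series into that of exp (k / c)
    without its constant term. *)
Lemma integral_bessel_series (k c : R) : 0 <= k -> 0 < c ->
  (\int[mu]_(s in `]0%R, +oo[) (expR (- (c * s)) * bessel_series k s)%:E =
   (expR (k / c) - 1)%:E)%E.
Proof.
move=> k0 c0.
have mt n : measurable_fun (setT : set R) (fun s => expR (- (c * s)) * bessel_coeff k s n).
  apply: measurable_funM.
    by apply: measurableT_comp => //; apply: measurableT_comp => //; exact: measurable_funM.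
  by apply: measurable_funM => //; apply: measurable_funM.
transitivity (\int[mu]_(s in `]0%R, +oo[)
    (\sum_(0 <= n <oo) (expR (- (c * s)) * bessel_coeff k s n)%:E))%E.
  apply: eq_integral => s; rewrite inE/= in_itv/= andbT => s0.
  rewrite EFinM -bessel_seriesE ?(ltW s0)// -nneseriesZl//.
  by move=> n _; rewrite lee_fin bessel_coeff_ge0// ltW.
rewrite integral_nneseries//=; last 2 first.
- by move=> n; apply/measurable_EFinP; apply: measurable_funTS; exact: mt.
- move=> n s; rewrite in_itv/= andbT => s0.
  by rewrite lee_fin mulr_ge0 ?expR_ge0// bessel_coeff_ge0// ltW.
rewrite -series_exp_coeffS; apply: eq_eseriesr => n _.
rewrite integral_itv_obnd_cbnd; last first.
  by apply/measurable_EFinP; apply: measurable_funTS; exact: mt.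
transitivity (\int[mu]_(s in `[0%R, +oo[) ((k ^+ n.+1 / (n.+1`! * n`!)%:R)%:E *
    (s ^+ n * expR (- (c * s)))%:E))%E.
  apply: eq_integral => s _; rewrite -EFinM; congr EFin.
  by rewrite /bessel_coeff; ring.
rewrite ge0_integralZl_EFin//; last 3 first.
- move=> s; rewrite /= in_itv/= andbT => s0.
  by rewrite lee_fin mulr_ge0 ?expR_ge0// exprn_ge0.
- apply/measurable_EFinP; apply: measurable_funTS; apply: measurable_funM => //.
  by apply: measurableT_comp => //; apply: measurableT_comp => //; exact: measurable_funM.
- by rewrite mulr_ge0 ?exprn_ge0// invr_ge0 ler0n.
rewrite integral_exprn_expRN// -EFinM; congr EFin.
rewrite /exp_coeff/= expr_div_n natrM.
have f1 : n.+1`!%:R != 0 :> R by rewrite pnatr_eq0 -lt0n fact_gt0.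
have f2 : n`!%:R != 0 :> R by rewrite pnatr_eq0 -lt0n fact_gt0.
have cn : c ^+ n.+1 != 0 by rewrite expf_neq0// gt_eqF.
move: f1 f2 cn; move: (n.+1`!%:R) (n`!%:R) (c ^+ n.+1) (k ^+ n.+1) => A B C K A0 B0 C0.
by field; rewrite A0 B0 C0.
Qed.

(** A sum of a Poisson number, of mean b T, of exponential variables of rate b
    has an atom of mass exp (- b T) at 0.  Here the atom is replaced by an
    exponential law of the same mass, which is what the regularization of the
    Rosenau kernel amounts to. *)
Definition mixing_density (b T : R) : R -> R :=
  (fun s => expR (- (b * T)) *
     (expR (- (b * s)) * (b + bessel_series (b ^+ 2 * T) s))) \_ `]0, +oo[.

Lemma mixing_density_le0 b T s : s <= 0 -> mixing_density b T s = 0.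
Proof.
by move=> s0; rewrite /mixing_density patchE memNset//= in_itv/= andbT; lra.
Qed.

Lemma mixing_densityE b T s : 0 < s -> mixing_density b T s =
  expR (- (b * T)) * (expR (- (b * s)) * (b + bessel_series (b ^+ 2 * T) s)).
Proof. by move=> s0; rewrite /mixing_density patchE mem_set//= in_itv/= s0. Qed.

Lemma mixing_density_ge0 b T s : 0 <= b -> 0 <= T -> 0 <= mixing_density b T s.
Proof.
move=> b0 T0; have [s0|s0] := leP s 0; first by rewrite mixing_density_le0.
rewrite mixing_densityE// !mulr_ge0 ?expR_ge0// addr_ge0// bessel_series_ge0 ?(ltW s0)//.
by rewrite mulr_ge0// sqr_ge0.
Qed.

Lemma measurable_bessel_series k : 0 <= k ->
  measurable_fun (`]0, +oo[%classic : set R) (bessel_series k).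
Proof.
move=> k0; apply/measurable_EFinP.
apply: (eq_measurable_fun (fun s => \sum_(0 <= n <oo) (bessel_coeff k s n)%:E)%E).
  by move=> s; rewrite inE/= in_itv/= andbT => s0; rewrite bessel_seriesE// ltW.
apply: ge0_emeasurable_sum => n.
  move=> s; rewrite /= in_itv/= andbT => s0 _.
  by rewrite lee_fin bessel_coeff_ge0// ltW.
move=> _; apply/measurable_EFinP; apply: measurable_funTS.
by apply: measurable_funM => //; apply: measurable_funM.
Qed.

Lemma measurable_expRNM (c : R) : measurable_fun setT (fun s => expR (- (c * s))).
Proof.
by apply: measurableT_comp => //; apply: measurableT_comp => //; exact: measurable_funM.
Qed.

Lemma measurable_mixing_density b T : 0 <= T ->
  measurable_fun setT (mixing_density b T).
Proof.
move=> T0; apply/(measurable_restrictT _ _).1 => //.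
apply: measurable_funM => //; apply: measurable_funM.
  by apply: measurable_funTS; exact: measurable_expRNM.
apply: measurable_funD => //; apply: measurable_bessel_series.
by rewrite mulr_ge0// sqr_ge0.
Qed.

Lemma laplace_mixing_density b T u : 0 < b -> 0 <= T -> 0 <= u ->
  (\int[mu]_s (expR (- (u * s)) * mixing_density b T s)%:E =
   (mixing_laplace b T u)%:E)%E.
Proof.
move=> b0 T0 u0; have bu0 : 0 < b + u by lra.
have k0 : 0 <= b ^+ 2 * T by rewrite mulr_ge0// sqr_ge0.
have mB := measurable_bessel_series _ k0.
have mE : measurable_fun (`]0, +oo[%classic : set R)
    (fun s => expR (- ((b + u) * s))).
  by apply: measurable_funTS; exact: measurable_expRNM.
transitivity (\int[mu]_(s in `]0%R, +oo[) ((expR (- (b * T)))%:E *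
    ((b * expR (- ((b + u) * s)))%:E +
     (expR (- ((b + u) * s)) * bessel_series (b ^+ 2 * T) s)%:E)))%E.
  rewrite [RHS]integral_mkcond; apply: eq_integral => s _; rewrite patchE.
  case: ifPn; rewrite ?(inE, notin_setE)/= in_itv/= andbT => s0.
    rewrite mixing_densityE// -EFinD -EFinM; congr EFin.
    by rewrite mulrDl opprD expRD; ring.
  by rewrite mixing_density_le0 ?mulr0//; move/negP : s0; rewrite -leNgt.
rewrite ge0_integralZl_EFin//; last 2 first.
- move=> s; rewrite /= in_itv/= andbT => s0; rewrite adde_ge0// lee_fin.
    by rewrite mulr_ge0 ?expR_ge0// ltW.
  by rewrite mulr_ge0 ?expR_ge0// bessel_series_ge0// ltW.
- apply: emeasurable_funD; apply/measurable_EFinP; apply: measurable_funM => //.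
rewrite (@ge0_integralD _ _ R mu `]0%R, +oo[%classic _
  (fun s => (b * expR (- ((b + u) * s)))%:E)
  (fun s => (expR (- ((b + u) * s)) * bessel_series (b ^+ 2 * T) s)%:E))//;
  last 4 first.
- by move=> s _; rewrite lee_fin mulr_ge0 ?expR_ge0// ltW.
- by apply/measurable_EFinP; apply: measurable_funM.
- move=> s; rewrite /= in_itv/= andbT => s0.
  by rewrite lee_fin mulr_ge0 ?expR_ge0// bessel_series_ge0// ltW.
- by apply/measurable_EFinP; apply: measurable_funM.
rewrite integral_bessel_series//.
under eq_integral do rewrite EFinM.
rewrite ge0_integralZl_EFin//; last 2 first.
- exact/measurable_EFinP.
- exact: ltW.
rewrite integral_itv_obnd_cbnd; last first.
  by apply/measurable_EFinP; apply: measurable_funTS; exact: measurable_expRNM.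
have := integral_exprn_expRN (b + u) 0 bu0.
under eq_integral do rewrite expr0 mul1r.
move=> ->; rewrite -EFinM; congr EFin.
rewrite /mixing_laplace fact0 expr1 div1r.
rewrite (_ : b ^+ 2 * T / (b + u) = b * T * (b / (b + u))); last by ring.
by ring.
Qed.

Lemma integral_mixing_density b T : 0 < b -> 0 <= T ->
  (\int[mu]_s (mixing_density b T s)%:E = 1)%E.
Proof.
move=> b0 T0; have := laplace_mixing_density b T 0 b0 T0 (lexx _).
under eq_integral do rewrite mul0r oppr0 expR0 mul1r.
move=> ->; rewrite /mixing_laplace addr0 divff ?gt_eqF// mulr1 subrr subr0.
by rewrite -expRD addNr expR0.
Qed.

Lemma integrable_mixing_density b T : 0 < b -> 0 <= T ->
  mu.-integrable setT (EFin \o mixing_density b T).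
Proof.
move=> b0 T0; apply/integrableP; split.
  by apply/measurable_EFinP; exact: measurable_mixing_density.
rewrite (_ : integral _ _ _ = (\int[mu]_s (mixing_density b T s)%:E)%E).
  by rewrite integral_mixing_density// ltry.
by apply: eq_integral => s _ /=; rewrite ger0_norm// mixing_density_ge0// ltW.
Qed.

End mixing_density.

(** * Distance between Gaussians of different widths *)

Section gauss_distance.
Context {R : realType}.
Local Notation mu := (@lebesgue_measure R).

(** Scaled by sqrt (p / q), the narrower density takes the same value at 0 as
    the wider one, and it decays faster. *)
Lemma gauss_scaled_le (p q v : R) : 0 < p -> p <= q ->
  Num.sqrt (p / q) * gauss p v <= gauss q v.
Proof.
move=> p0 pq; have q0 : 0 < q by lra.
rewrite /gauss mulrA.
have -> : Num.sqrt (p / q) / Num.sqrt (4 * pi * p) = (Num.sqrt (4 * pi * q))^-1.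
  have pi0 := pi_gt0 R.
  have h (x : R) : 0 < x -> 0 < Num.sqrt (4 * pi * x).
    by move=> x0; rewrite sqrtr_gt0 mulr_gt0// mulr_gt0.
  rewrite (_ : p / q = (4 * pi * p) / (4 * pi * q)); last first.
    by rewrite -mulf_div divff ?mul1r// gt_eqF// mulr_gt0.
  rewrite sqrtrM; last by rewrite !mulr_ge0// ltW.
  by rewrite sqrtrV ?mulr_ge0 ?(ltW pi0) ?(ltW q0)// mulrAC divff ?mul1r// gt_eqF ?h.
apply: ler_wpM2l; first by rewrite invr_ge0 sqrtr_ge0.
rewrite ler_expR lerN2 ler_wpM2l ?sqr_ge0// lef_pV2 ?posrE; lra.
Qed.

(** With r = sqrt (p / q), [gauss_scaled_le] gives
    |G_p - G_q| <= (G_q - r G_p) + (1 - r) G_p, of integral 2 (1 - r), and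
    r >= p / q. *)
Lemma gauss_L1_dist_le (p q : R) : 0 < p -> p <= q ->
  \int[mu]_v `|gauss p v - gauss q v| <= 2 * (1 - p / q).
Proof.
move=> p0 pq; have q0 : 0 < q by lra.
set r := Num.sqrt (p / q).
have pq0 : 0 < p / q by rewrite divr_gt0.
have pq1 : p / q <= 1 by rewrite ler_pdivrMr// mul1r.
have r2 : r ^+ 2 = p / q by rewrite sqr_sqrtr// ltW.
have r0 : 0 <= r by exact: sqrtr_ge0.
have r1 : r <= 1 by nra.
have ip := integrable_gauss p; have iq := integrable_gauss q.
have irp : mu.-integrable setT (EFin \o (fun v => (1 - 2 * r) * gauss p v)).
  exact: (integrableZl measurableT) ip.
have isum : mu.-integrable setT
    (EFin \o (fun v => gauss q v + (1 - 2 * r) * gauss p v)).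
  by have := integrableD measurableT iq irp.
have idiff : mu.-integrable setT (EFin \o (fun v => gauss p v - gauss q v)).
  by have := integrableB measurableT ip iq.
apply: (@le_trans _ _ (\int[mu]_v (gauss q v + (1 - 2 * r) * gauss p v))).
  apply: le_Rintegral => //; first by have := integrable_norm idiff.
  move=> v _; have := gauss_scaled_le p q v p0 pq; rewrite -/r.
  by have := gauss_ge0 p v; rewrite ler_norml => ? ?; apply/andP; split; nra.
rewrite (RintegralD measurableT iq irp) (RintegralZl _ measurableT ip).
rewrite !Rintegral_gauss//; nra.
Qed.

(** This form of the bound is chosen because the moments of exp (- s / T) under
    a law of s are values of its Laplace transform. *)
Lemma gauss_L1_dist_expR (s T : R) : 0 < s -> 0 < T ->
  \int[mu]_v `|gauss T v - gauss s v| <= 2 * `|1 - expR (1 - s / T)|.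
Proof.
move=> s0 T0; have sT0 : 0 < s / T by rewrite divr_gt0.
have [sT|Ts] := leP s T.
  under eq_Rintegral do rewrite distrC.
  apply: le_trans (gauss_L1_dist_le _ _ s0 sT) _.
  have := expR_ge1Dx (1 - s / T) => h.
  by rewrite ler_pM2l// distrC; apply: le_trans (ler_norm _); lra.
apply: le_trans (gauss_L1_dist_le _ _ T0 (ltW Ts)) _.
rewrite ler_pM2l//; apply: le_trans (ler_norm _); rewrite lerD2l lerN2.
rewrite -(opprB (s / T)) expRN -(invf_div s T) lef_pV2 ?posrE ?expR_gt0//.
by have := expR_ge1Dx (s / T - 1); lra.
Qed.

End gauss_distance.

(** * Mixtures of Gaussians *)

Section gauss_mixture.
Context {R : realType}.
Local Notation mu := (@lebesgue_measure R).

Lemma measurable_gauss2 :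
  measurable_fun setT (fun z : R * R => gauss z.2 z.1).
Proof.
rewrite /gauss; apply: measurable_funM.
  apply: measurable_funVr.
  apply: measurableT_comp.
    by apply: continuous_measurable_fun; exact: sqrt_continuous.
  by apply: measurable_funM.
apply: measurableT_comp => //; apply: measurableT_comp => //.
apply: measurable_funM; first exact: measurable_funX.
by apply: measurable_funVr; apply: measurable_funM.
Qed.

Definition gauss_mixture (rho : R -> R) (v : R) : R :=
  \int[mu]_s (gauss s v * rho s).

Context (rho : R -> R) (rho_int : mu.-integrable setT (EFin \o rho))
  (rho_ge0 : forall s, 0 <= rho s) (rho_le0 : forall s, s <= 0 -> rho s = 0).

(** The variable of the mixture comes first, so that the mixture is an inner
    integral in the second variable; integrability is checked in the other order,
    where each Gaussian contributes its mass 1. *)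
Lemma integrable_gauss_mixture2 : (mu \x mu)%E.-integrable setT
  (EFin \o (fun z : R * R => gauss z.2 z.1 * rho z.2)).
Proof.
have mrho := measurable_integrable _ rho_int.
have mf : measurable_fun setT (EFin \o (fun z : R * R => gauss z.2 z.1 * rho z.2)).
  apply/measurable_EFinP; apply: measurable_funM; last exact: measurableT_comp.
  exact: measurable_gauss2.
apply: ((@integrable21ltyP _ _ _ _ R mu mu _ mf).2).
rewrite (_ : (integral _ _ _) = (\int[mu]_s (rho s)%:E)%E); last first.
  apply: eq_integral => s _.
  transitivity (\int[mu]_v ((rho s)%:E * (gauss s v)%:E))%E.
    apply: eq_integral => v _.
    by rewrite /= ger0_norm ?mulr_ge0 ?gauss_ge0// mulrC.
  rewrite ge0_integralZl_EFin//; last 2 first.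
    by move=> v _; rewrite lee_fin gauss_ge0.
    by apply/measurable_EFinP; exact: measurable_gauss.
  have [s0|s0] := leP s 0; first by rewrite rho_le0// mul0e.
  by rewrite integral_gauss// mule1.
exact: integrable_lty rho_int.
Qed.

Lemma integrable_gauss_mixture :
  mu.-integrable setT (EFin \o gauss_mixture rho).
Proof. exact: (integrable_Rintegral1 _ integrable_gauss_mixture2). Qed.

Lemma gauss_mixture_even v : gauss_mixture rho (- v) = gauss_mixture rho v.
Proof. by apply: eq_Rintegral => s _; rewrite gauss_even. Qed.

Lemma fourier_cos_gauss_mixture xi :
  \int[mu]_v (cos (xi * v) * gauss_mixture rho v) =
  \int[mu]_s (expR (- (xi ^+ 2 * s)) * rho s).
Proof.
have i2 := integrable_gauss_mixture2.
have ik : (mu \x mu)%E.-integrable setT (EFin \o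
    (fun z : R * R => cos (xi * z.1) * (gauss z.2 z.1 * rho z.2))).
  apply: le_integrable (i2) => //.
    apply/measurable_EFinP; apply: measurable_funM.
      exact: (measurableT_comp (measurable_cosM xi)).
    by apply/measurable_EFinP; exact: measurable_int i2.
  by move=> z _ /=; rewrite lee_fin normrM ler_piMl// cos_max.
transitivity (\int[mu]_v \int[mu]_s (cos (xi * v) * (gauss s v * rho s))).
  have : {ae mu, forall v, mu.-integrable setT
      (EFin \o (fun s => gauss s v * rho s))} by exact: ae_integrable1 i2.
  move=> aei; congr fine; apply: ae_eq_integral => //.
  - apply/measurable_EFinP; apply: measurable_integrable; apply: integrable_cosM.
    exact: integrable_gauss_mixture.
  - apply/measurable_EFinP; apply: measurable_integrable.
    exact: (integrable_Rintegral1 _ ik).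
  apply: (@filterS _ _ (ae_filter_ringOfSetsType mu) _ _ _ aei) => v iv _.
  by rewrite (RintegralZl _ measurableT iv).
have F := Rintegral_Fubini _ ik; rewrite /= in F; rewrite F.
apply: eq_Rintegral => s _.
have [s0|s0] := leP s 0.
  rewrite rho_le0// mulr0 (_ : (fun _ => _) = cst 0) ?/Rintegral ?integral0//.
  by apply/funext => v; rewrite !mulr0.
rewrite mulrC (mulrC (xi ^+ 2)) -fourier_cos_gauss//.
rewrite -(RintegralZl _ measurableT (integrable_cosM xi _ (integrable_gauss s))).
by apply: eq_Rintegral => v _; ring.
Qed.

Context (rho_mass : (\int[mu]_s (rho s)%:E = 1)%E).

(** As rho has mass 1, G_T - mixture is the average of G_T - G_s under rho, for
    almost every v; the bound follows by exchanging the integrals. *)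
Lemma gauss_mixture_L1_dist (T : R) : 0 < T ->
  (\int[mu]_v (`|gauss T v - gauss_mixture rho v|)%:E <=
   \int[mu]_s (2 * `|1 - expR (1 - s / T)| * rho s)%:E)%E.
Proof.
move=> T0.
have mrho := measurable_integrable _ rho_int.
have mass1 : \int[mu]_s rho s = 1 by rewrite /Rintegral rho_mass.
pose f (z : R * R) := gauss T z.1 * rho z.2 - gauss z.2 z.1 * rho z.2.
have mgT : measurable_fun setT (gauss T) by exact: measurable_gauss.
have mf : measurable_fun setT f.
  apply: measurable_funB; first by apply: measurable_funM; exact: measurableT_comp.
  by apply: measurable_funM; [exact: measurable_gauss2|exact: measurableT_comp].
have mnf : measurable_fun setT (fun z => (`|f z|)%:E).
  by apply/measurable_EFinP; exact: measurableT_comp.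
have nf0 z : (0 <= (`|f z|)%:E)%E by rewrite lee_fin.
have mF := @measurable_fun_fubini_tonelli_F _ _ _ _ R mu _ mnf nf0.
have mG := @measurable_fun_fubini_tonelli_G _ _ _ _ R mu _ mnf nf0.
have i2 := integrable_gauss_mixture2.
apply: (@le_trans _ _ (\int[mu]_v \int[mu]_s (`|f (v, s)|)%:E)%E).
  apply: ae_ge0_le_integral => //.
  - apply/measurable_EFinP; apply: measurableT_comp => //.
    apply: measurable_funB => //.
    exact: measurable_integrable integrable_gauss_mixture.
  - by move=> v _; apply: integral_ge0 => s _; rewrite lee_fin.
  have : {ae mu, forall v, mu.-integrable setT
      (EFin \o (fun s => gauss s v * rho s))} by exact: ae_integrable1 i2.
  apply: (@filterS _ _ (ae_filter_ringOfSetsType mu)) => v iv _.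
  have irv : mu.-integrable setT (EFin \o (fun s => gauss T v * rho s)).
    exact: (integrableZl measurableT) rho_int.
  have iB : mu.-integrable setT (EFin \o (fun s => f (v, s))).
    by have := integrableB measurableT irv iv.
  rewrite integral_normr_fin_num// lee_fin.
  rewrite (_ : gauss T v - _ = \int[mu]_s f (v, s)).
    exact: le_normr_Rintegral.
  by rewrite (RintegralB measurableT irv iv) (RintegralZl _ measurableT rho_int) mass1 mulr1.
rewrite (@fubini_tonelli _ _ _ _ R mu mu _ mnf nf0).
apply: ge0_le_integral => //.
- by move=> s _; apply: integral_ge0 => v _; rewrite lee_fin.
- apply/measurable_EFinP; apply: measurable_funM => //; apply: measurable_funM => //.
  apply: measurableT_comp => //; apply: measurable_funB => //.
  by apply: measurableT_comp => //; apply: measurable_funB => //; exact: measurable_funM.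
move=> s _; have [s0|s0] := leP s 0.
  rewrite rho_le0// mulr0 integral0_eq// => v _.
  by rewrite /f /= rho_le0// !mulr0 subrr normr0.
rewrite (_ : integral _ _ _ =
    ((\int[mu]_v `|gauss T v - gauss s v|) * rho s)%:E); last first.
  have iD : mu.-integrable setT (EFin \o (fun v => gauss T v - gauss s v)).
    by have := integrableB measurableT (integrable_gauss T) (integrable_gauss s).
  rewrite EFinM -integral_normr_fin_num// -ge0_integralZr//; last 2 first.
  - by apply/measurable_EFinP; exact: measurableT_comp (measurable_integrable _ iD).
  - by rewrite lee_fin.
  apply: eq_integral => v _.
  by rewrite /f /= -mulrBl normrM (ger0_norm (rho_ge0 s)).
by rewrite lee_fin ler_wpM2r// gauss_L1_dist_expR.
Qed.

End gauss_mixture.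

(** * Concentration of the subordinator *)

Section concentration.
Context {R : realType}.
Local Notation mu := (@lebesgue_measure R).

(** The exponent b T b / (b + theta / T) - b T equals
    - theta b / (b + theta / T), and the remaining term carries exp (- b T). *)
Lemma mixing_laplace_cvg (b theta : R) : 0 < b -> 0 < theta ->
  mixing_laplace b T (theta / T) @[T --> +oo] --> expR (- theta).
Proof.
move=> b0 th0.
have Ty : theta / T @[T --> +oo] --> 0.
  rewrite -(mulr0 theta); apply: cvgMr.
  have pos : \forall x \near +oo, 0 < (x : R) by exact: nbhs_pinfty_gt.
  by apply: (gtr0_cvgV0 pos).2; exact: cvg_id.
have my : b / (b + theta / T) @[T --> +oo] --> (1 : R).
  rewrite -(divff (lt0r_neq0 b0)); apply: cvgMr; apply: cvgV; first exact: lt0r_neq0.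
  by rewrite -{2}(addr0 b); apply: cvgD; [exact: cvg_cst|].
have ey : expR (- (b * T)) @[T --> +oo] --> 0.
  exact: (cvg_comp _ _ (gt0_cvgMry b0 cvg_id) (@cvgr_expR R)).
have E : \forall T \near +oo, expR (- (theta * (b / (b + theta / T)))) -
    expR (- (b * T)) * (1 - b / (b + theta / T)) = mixing_laplace b T (theta / T).
  near=> T; have T0 : 0 < T by near: T; exact: nbhs_pinfty_gt.
  have D0 : 0 < b * T + theta by rewrite addr_gt0// mulr_gt0.
  rewrite /mixing_laplace [RHS]mulrBr -expRD; congr (expR _ - _).
  by field; rewrite !gt_eqF.
have : expR (- (theta * (b / (b + theta / T)))) -
    expR (- (b * T)) * (1 - b / (b + theta / T)) @[T --> +oo] --> expR (- theta).
  rewrite -[X in _ --> X]subr0 -(mul0r (1 - 1 : R)); apply: cvgB.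
    apply: continuous_cvg; first exact: continuous_expR.
    by apply: cvgN; rewrite -[X in _ --> X]mulr1; apply: cvgMr.
  by apply: cvgM => //; apply: cvgB => //; exact: cvg_cst.
by apply: cvg_trans; apply: near_eq_cvg.
Unshelve. all: end_near. Qed.

(** The second moment of 1 - exp (1 - s / T) under [mixing_density b T]:
    expanding the square leaves the Laplace transform at 0, 1 / T and 2 / T. *)
Definition mixing_spread (b T : R) : R :=
  1 - 2 * expR 1 * mixing_laplace b T (1 / T) + expR 1 ^+ 2 * mixing_laplace b T (2 / T).

(** In the limit the three terms are those of (1 - e e^-1)^2 = 0. *)
Lemma mixing_spread_cvg (b : R) : 0 < b -> mixing_spread b T @[T --> +oo] --> 0.
Proof.
move=> b0; rewrite [X in _ --> X](_ : 0 =
    1 - 2 * expR 1 * expR (- 1) + expR 1 ^+ 2 * expR (- 2)); last first.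
  rewrite -mulrA -expRD subrr expR0 -(expRM_natl 2) -expRD mulr1 subrr expR0; ring.
apply: cvgD; last by apply: cvgMr; exact: mixing_laplace_cvg.
apply: cvgB; first exact: cvg_cst.
by apply: cvgMr; exact: mixing_laplace_cvg.
Qed.

Lemma integrable_laplace_mixing (b T u : R) : 0 < b -> 0 <= T -> 0 <= u ->
  mu.-integrable setT (EFin \o (fun s => expR (- (u * s)) * mixing_density b T s)).
Proof.
move=> b0 T0 u0; have ir := integrable_mixing_density b T b0 T0.
apply: le_integrable (ir) => //.
  apply/measurable_EFinP; apply: measurable_funM; first exact: measurable_expRNM.
  exact: measurable_mixing_density.
move=> s _ /=; rewrite lee_fin normrM.
have [s0|s0] := leP s 0; first by rewrite mixing_density_le0// normr0 mulr0.
rewrite ler_piMl// ger0_norm ?expR_ge0// -expR0 ler_expR oppr_le0 mulr_ge0//.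
exact: ltW.
Qed.

(** The pointwise inequality 2 |y| <= d + y^2 / d with y = 1 - exp (1 - s / T)
    replaces the Cauchy-Schwarz inequality, and makes only [mixing_spread] appear. *)
Lemma mixing_deviation_le (b T d : R) : 0 < b -> 0 < T -> 0 < d ->
  (\int[mu]_s (2 * `|1 - expR (1 - s / T)| * mixing_density b T s)%:E <=
   (d + mixing_spread b T / d)%:E)%E.
Proof.
move=> b0 T0 d0; have T0' := ltW T0; set rho := mixing_density b T.
have rho0 s : 0 <= rho s by exact: mixing_density_ge0 (ltW b0) T0'.
have ir : mu.-integrable setT (EFin \o rho) := integrable_mixing_density b T b0 T0'.
have u1 : 0 <= 1 / T by rewrite divr_ge0.
have u2 : 0 <= 2 / T by rewrite divr_ge0.
have i1 := integrable_laplace_mixing b T (1 / T) b0 T0' u1.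
have i2 := integrable_laplace_mixing b T (2 / T) b0 T0' u2.
have L1 := laplace_mixing_density b T (1 / T) b0 T0' u1.
have L2 := laplace_mixing_density b T (2 / T) b0 T0' u2.
rewrite -/rho in i1 i2 L1 L2.
(* g is (d + y^2 / d) rho with y = 1 - exp (1 - s / T), expanded in powers of exp (- s / T). *)
pose g s := (d + d^-1) * rho s + ((- (2 * expR 1 / d)) * (expR (- (1 / T * s)) * rho s) +
  (expR 1 ^+ 2 / d) * (expR (- (2 / T * s)) * rho s)).
have j0 : mu.-integrable setT (EFin \o (fun s => (d + d^-1) * rho s)).
  exact: (integrableZl measurableT) ir.
have j1 : mu.-integrable setT (EFin \o
    (fun s => (- (2 * expR 1 / d)) * (expR (- (1 / T * s)) * rho s))).
  exact: (integrableZl measurableT) i1.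
have j2 : mu.-integrable setT (EFin \o
    (fun s => (expR 1 ^+ 2 / d) * (expR (- (2 / T * s)) * rho s))).
  exact: (integrableZl measurableT) i2.
have j12 : mu.-integrable setT (EFin \o
    (fun s => (- (2 * expR 1 / d)) * (expR (- (1 / T * s)) * rho s) +
              (expR 1 ^+ 2 / d) * (expR (- (2 / T * s)) * rho s))).
  by have := integrableD measurableT j1 j2.
have jg : mu.-integrable setT (EFin \o g) by have := integrableD measurableT j0 j12.
have -> : (d + mixing_spread b T / d)%:E = (\int[mu]_s (g s)%:E)%E.
  rewrite -[RHS]fineK; last exact: integrable_fin_num jg.
  congr EFin; rewrite -/(Rintegral mu setT g).
  rewrite (RintegralD measurableT j0 j12) (RintegralD measurableT j1 j2).
  rewrite (RintegralZl _ measurableT ir) (RintegralZl _ measurableT i1).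
  rewrite (RintegralZl _ measurableT i2) /Rintegral L1 L2 integral_mixing_density//=.
  by rewrite /mixing_spread; field; rewrite gt_eqF.
apply: ge0_le_integral => //.
- by move=> s _; rewrite lee_fin !mulr_ge0.
- apply/measurable_EFinP; apply: measurable_funM; last exact: measurable_integrable.
  apply: measurable_funM => //; apply: measurableT_comp => //.
  apply: measurable_funB => //; apply: measurableT_comp => //.
  by apply: measurable_funB => //; exact: measurable_funM.
- exact: measurable_int jg.
move=> s _; rewrite lee_fin /g.
have -> : expR (- (1 / T * s)) = expR (1 - s / T) * expR (- 1).
  by rewrite -expRD; congr expR; ring.
have -> : expR (- (2 / T * s)) = expR (1 - s / T) ^+ 2 * expR (- 1) ^+ 2.
  by rewrite -!expRM_natl -expRD; congr expR; ring.
have e1 : expR 1 * expR (- 1) = 1 :> R by rewrite -expRD subrr expR0.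
set y := expR (1 - s / T).
have -> : (d + d^-1) * rho s + (- (2 * expR 1 / d) * (y * expR (-1) * rho s) +
    expR 1 ^+ 2 / d * (y ^+ 2 * expR (-1) ^+ 2 * rho s)) =
    (d + (1 - y) ^+ 2 / d) * rho s.
  have -> : expR (- 1) = (expR 1)^-1 :> R by rewrite expRN.
  by field; rewrite !gt_eqF ?expR_gt0.
apply: ler_wpM2r => //.
rewrite -(ler_pM2r d0) [leRHS]mulrDl divfK ?gt_eqF// -(real_normK (num_real (1 - y))).
have := normr_ge0 (1 - y); move: `|1 - y| => z z0.
by have := sqr_ge0 (d - z); nra.
Qed.

End concentration.

(** * Convergence of the kernels *)

Section kernel_convergence.
Context {R : realType}.
Local Notation mu := (@lebesgue_measure R).

Lemma L1_4_integrable (f : R -> R) : L1_4 f -> mu.-integrable setT (EFin \o f).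
Proof.
move=> [mf foo]; apply/integrableP; split; first exact/measurable_EFinP.
apply: le_lt_trans foo; apply: ge0_le_integral => //.
- by apply/measurable_EFinP; exact: measurableT_comp.
- apply/measurable_EFinP; apply: measurable_funM; first exact: measurableT_comp.
  by apply: measurable_funX; apply: measurable_funD.
move=> v _ /=; rewrite lee_fin ler_peMr// exprn_ege1//.
by rewrite lerDl sqr_ge0.
Qed.

(** Young's inequality for the difference of the kernels.  The two convolutions
    may be subtracted under the integral sign wherever both converge, which is
    almost everywhere. *)
Lemma convolutionB_L1_le (f g1 g2 : R -> R) :
  mu.-integrable setT (EFin \o f) ->
  mu.-integrable setT (EFin \o g1) -> mu.-integrable setT (EFin \o g2) ->
  (\int[mu]_v (`|convolution f g1 v - convolution f g2 v|)%:E <=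
   (\int[mu]_v `|f v|)%:E * \int[mu]_v (`|g1 v - g2 v|)%:E)%E.
Proof.
move=> jf j1 j2.
have k1 := integrable_conv _ _ jf j1; have k2 := integrable_conv _ _ jf j2.
have mf := measurable_integrable _ jf.
have iB : mu.-integrable setT (EFin \o (fun w => g1 w - g2 w)).
  by have := integrableB measurableT j1 j2.
have kB := integrable_conv _ _ jf iB.
pose F (z : R * R) := (`|f (z.1 - z.2) * (g1 z.2 - g2 z.2)|)%:E.
have mF : measurable_fun setT F.
  have /integrableP[/measurable_EFinP mB _] := kB.
  by apply/measurable_EFinP; exact: measurableT_comp mB.
have F0 z : (0 <= F z)%E by rewrite lee_fin.
have mF1 := @measurable_fun_fubini_tonelli_F _ _ _ _ R mu _ mF F0.
apply: (@le_trans _ _ (\int[mu]_v \int[mu]_w F (v, w))%E).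
  apply: ae_ge0_le_integral => //.
  - apply/measurable_EFinP; apply: measurableT_comp => //.
    apply: measurable_funB; apply: measurable_integrable.
      exact: (integrable_Rintegral1 _ k1).
    exact: (integrable_Rintegral1 _ k2).
  - by move=> v _; apply: integral_ge0 => w _; exact: F0.
  have a1 : {ae mu, forall v, mu.-integrable setT
      (EFin \o (fun w => f (v - w) * g1 w))} by exact: ae_integrable1 k1.
  have a2 : {ae mu, forall v, mu.-integrable setT
      (EFin \o (fun w => f (v - w) * g2 w))} by exact: ae_integrable1 k2.
  apply: (@filterS2 _ _ (ae_filter_ringOfSetsType mu) _ _ _ _ a1 a2) => v i1 i2 _.
  have i12 : mu.-integrable setT (EFin \o (fun w => f (v - w) * (g1 w - g2 w))).
    apply: eq_integrable (integrableB measurableT i1 i2) => // w _ /=.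
    by rewrite -EFinB mulrBr.
  rewrite /F /= integral_normr_fin_num// lee_fin.
  rewrite /convolution -(RintegralB measurableT i1 i2).
  under eq_Rintegral do rewrite -mulrBr.
  exact: le_normr_Rintegral.
rewrite (@fubini_tonelli _ _ _ _ R mu mu _ mF F0).
rewrite le_eqVlt; apply/orP; left; apply/eqP.
transitivity (\int[mu]_w ((\int[mu]_v `|f v|)%:E * (`|g1 w - g2 w|)%:E))%E; last first.
  rewrite ge0_integralZl_EFin//.
  - by apply/measurable_EFinP; exact: measurableT_comp (measurable_integrable _ iB).
  - exact: Rintegral_ge0.
apply: eq_integral => w _; rewrite -(integral_normr_fin_num _ jf) -ge0_integralZr//.
- rewrite -(integral_translate w (fun v => (`|f v|)%:E * (`|g1 w - g2 w|)%:E)%E).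
    by apply: eq_integral => v _; rewrite /F/= normrM.
  by apply/measurable_EFinP; apply: measurable_funM => //; exact: measurableT_comp.
- by apply/measurable_EFinP; exact: measurableT_comp.
Qed.

Lemma fourier_transform_unique (p q : R -> R) :
  mu.-integrable setT (EFin \o p) -> mu.-integrable setT (EFin \o q) ->
  (forall xi, \int[mu]_v (cos (xi * v) * p v) = \int[mu]_v (cos (xi * v) * q v)) ->
  (forall xi, \int[mu]_v (sin (xi * v) * p v) = \int[mu]_v (sin (xi * v) * q v)) ->
  {ae mu, forall v, p v = q v}.
Proof.
move=> ip iq hc hs.
have iB : mu.-integrable setT (EFin \o (fun v => p v - q v)).
  by have := integrableB measurableT ip iq.
have : {ae mu, forall v, p v - q v = 0}.
  apply: fourier_injective => // xi.
    under eq_Rintegral do rewrite mulrBr.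
    rewrite (RintegralB measurableT (integrable_cosM xi _ ip) (integrable_cosM xi _ iq)).
    by rewrite hc subrr.
  under eq_Rintegral do rewrite mulrBr.
  rewrite (RintegralB measurableT (integrable_sinM xi _ ip) (integrable_sinM xi _ iq)).
  by rewrite hs subrr.
by apply: (@filterS _ _ (ae_filter_ringOfSetsType mu)) => v /eqP; rewrite subr_eq0 => /eqP.
Qed.

(** Both sides are integrable and have the same transform: the cosine transform
    of the mixture is the Laplace transform of its density at xi^2, and its sine
    transform vanishes by parity, as does the imaginary part of the given one. *)
Lemma reg_kernel_gauss_mixture (lambda eps t : R) (p : R -> R) :
  0 < eps -> 0 <= lambda * t ->
  has_fourier_transform p (reg_kernel_hat lambda eps t) ->
  {ae mu, forall v, p v = gauss_mixture (mixing_density (eps ^- 2) (lambda * t)) v}.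
Proof.
move=> e0 lt0 [ip Fp].
have b0 : 0 < eps ^- 2 by rewrite invr_gt0 exprn_gt0.
set b := eps ^- 2 in b0 *; set T := lambda * t.
have ir := integrable_mixing_density b T b0 lt0.
have rho0 s : 0 <= mixing_density b T s by exact: mixing_density_ge0 (ltW b0) lt0.
have rhole0 s : s <= 0 -> mixing_density b T s = 0 by exact: mixing_density_le0.
have iq := integrable_gauss_mixture _ ir rho0 rhole0.
have E xi : fourier p xi = reg_kernel_hat lambda eps t xi by rewrite Fp.
have Ec xi := congr1 (@complex.Re R) (E xi).
have Es xi := congr1 (@complex.Im R) (E xi).
apply: (fourier_transform_unique _ _) => // xi.
- move: (Ec xi); rewrite fourierE// reg_kernel_hatE//= -/b -/T => ->.
  rewrite (fourier_cos_gauss_mixture _ ir rho0 rhole0).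
  by rewrite /Rintegral laplace_mixing_density// sqr_ge0.
- rewrite [RHS]Rintegral_sin_even//; last exact: gauss_mixture_even.
  move: (Es xi); rewrite fourierE// reg_kernel_hatE//=; lra.
Qed.

(** For given e, take d = e / 2 in [mixing_deviation_le] and T so large that the
    spread is at most d^2. *)
Lemma gauss_mixture_dist_cvg (b : R) : 0 < b ->
  (\int[mu]_v (`|gauss T v - gauss_mixture (mixing_density b T) v|)%:E
    @[T --> +oo%R] --> 0)%E.
Proof.
move=> b0; have S0 := mixing_spread_cvg b b0.
pose N T := (\int[mu]_v (`|gauss T v - gauss_mixture (mixing_density b T) v|)%:E)%E.
have NE T d : 0 < T -> 0 < d -> (N T <= (d + mixing_spread b T / d)%:E)%E.
  move=> T0 d0; have T0' := ltW T0.
  apply: le_trans (mixing_deviation_le b T d b0 T0 d0).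
  apply: gauss_mixture_L1_dist => //.
  - exact: integrable_mixing_density.
  - by move=> s; apply: mixing_density_ge0 => //; exact: ltW.
  - exact: mixing_density_le0.
  - exact: integral_mixing_density.
have N0 T : (0 <= N T)%E by apply: integral_ge0 => v _; rewrite lee_fin.
have Nf : \forall T \near +oo, N T \is a fin_num.
  near=> T; have T0 : 0 < T by near: T; exact: nbhs_pinfty_gt.
  by rewrite ge0_fin_numE//; apply: le_lt_trans (NE T 1 T0 ltr01) (ltry _).
apply/fine_cvgP; split; first exact: Nf.
apply/cvgr0Pnorm_le => e e0.
have e2 : 0 < e / 2 by rewrite divr_gt0.
have e4 : 0 < (e / 2) ^+ 2 by rewrite exprn_gt0.
near=> T.
have T0 : 0 < T by near: T; exact: nbhs_pinfty_gt.
have fT : N T \is a fin_num by near: T; exact: Nf.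
suff : (N T <= e%:E)%E.
  by rewrite -{1}(fineK fT) lee_fin => h; rewrite /= (ger0_norm (fine_ge0 (N0 T))).
apply: le_trans (NE T (e / 2) T0 e2) _; rewrite lee_fin.
have : mixing_spread b T <= (e / 2) ^+ 2.
  apply: le_trans (ler_norm _) _; near: T.
  exact: (cvgr0_norm_le _ S0 _ e4).
rewrite -(ler_pM2r (_ : 0 < (e / 2)^-1)) ?invr_gt0// expr2 mulfK ?gt_eqF//; lra.
Unshelve. all: end_near. Qed.

End kernel_convergence.

Theorem theorem4p2 (R : realType) (sigma eps m4 : R) (g0 : R -> R)
    (P : R -> R -> R)
    (sigma_gt0 : 0 < sigma) (eps_gt0 : 0 < eps) (m4_gt0 : 0 < m4)
    (g0_L1_4 : L1_4 g0)
    (g0_ge0 : {ae (@lebesgue_measure R), forall v, 0 <= g0 v})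
    (g0_mass : \int[@lebesgue_measure R]_v g0 v = 1)
    (g0_mean : \int[@lebesgue_measure R]_v (v * g0 v) = 0)
    (g0_energy : \int[@lebesgue_measure R]_v (v ^+ 2 / 2 * g0 v) = 1)
    (g0_third : \int[@lebesgue_measure R]_v (v ^+ 3 * g0 v) = 0)
    (g0_fourth : \int[@lebesgue_measure R]_v (v ^+ 4 * g0 v) = m4)
    (P_reg : is_reg_kernel (sigma ^+ 2) eps P) :
  ('N[@lebesgue_measure R]_1
     [EFin \o (heat_solution sigma g0 t \- convolution g0 (P t))%R])%E
    @[t --> +oo] --> 0%E.
Proof.
set mu := @lebesgue_measure R.
have s20 : 0 < sigma ^+ 2 by rewrite exprn_gt0.
have b0 : 0 < eps ^- 2 by rewrite invr_gt0 exprn_gt0.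
have ig0 := L1_4_integrable _ g0_L1_4.
pose D T := (\int[mu]_v (`|gauss T v - gauss_mixture (mixing_density (eps ^- 2) T) v|)%:E)%E.
pose C := (\int[mu]_v `|g0 v|)%:E.
have Dc : (C * D (sigma ^+ 2 * t)%R @[t --> +oo%R] --> 0)%E.
  rewrite -(mule0 C); apply: cvgeZl => //.
  exact: (cvg_comp _ _ (gt0_cvgMry s20 cvg_id) (gauss_mixture_dist_cvg _ b0)).
apply: (squeeze_cvge _ (cvg_cst 0%E) Dc).
near=> t; have t0 : 0 < t by near: t; exact: nbhs_pinfty_gt.
rewrite Lnorm_ge0/= Lnorm1.
have T0 : 0 < sigma ^+ 2 * t by rewrite mulr_gt0.
have [iP FP] := P_reg t t0.
have aeP := reg_kernel_gauss_mixture _ _ _ _ eps_gt0 (ltW T0) (conj iP FP).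
have hk : heat_kernel sigma t = gauss (sigma ^+ 2 * t).
  by apply/funext => v; exact: heat_kernelE.
have ig := integrable_gauss (sigma ^+ 2 * t).
have -> : D (sigma ^+ 2 * t) =
    (\int[mu]_v (`|gauss (sigma ^+ 2 * t) v - P t v|)%:E)%E.
  apply: ae_eq_integral => //.
  - apply/measurable_EFinP; apply: measurableT_comp => //.
    apply: measurable_funB; first exact: measurable_gauss.
    apply: measurable_integrable; apply: integrable_gauss_mixture.
    + by apply: integrable_mixing_density => //; exact: ltW.
    + by move=> s; apply: mixing_density_ge0; exact: ltW.
    + exact: mixing_density_le0.
  - apply/measurable_EFinP; apply: measurableT_comp => //.
    apply: measurable_funB; first exact: measurable_gauss.
    exact: measurable_integrable iP.
  - by apply: (@filterS _ _ (ae_filter_ringOfSetsType mu) _ _ _ aeP) => v -> _.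
by rewrite /heat_solution hk; exact: convolutionB_L1_le.
Unshelve. all: end_near. Qed.
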